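(* Let $n>0$ be an integer and let $(T^{2n+2},\omega_0)$ be the standard $(2n+2)$-dimensional torus with the standard symplectic form $\omega_0=dx^1\wedge dx^2+\cdots+dx^{2n+1}\wedge dx^{2n+2}$. Then there are infinitely many $\omega_0$-compatible almost complex structures $J$ on $T^{2n+2}$ such that $$b^1>2h^{1,0}=2\ell^{1,0},$$ where $b^1$ is the first Betti number of $T^{2n+2}$ and $h^{1,0},\ell^{1,0}$ are computed with respect to $J$ and the metric determined by $(\omega_0,J)$. Moreover, for any integer $k$ with $0<k\le n$, there are infinitely many $\omega_0$-compatible almost complex structures $J$ on $T^{2n+2}$ satisfying $$h^{1,0}=\ell^{1,0}=n-k+1.$$
   Context: All objects are smooth. An almost complex structure on a manifold $M$ of real dimension $2m$ is a section $J$ of $\mathrm{End}(TM)$ with $J^2=-\mathrm{Id}$. Given a symplectic form $\omega$ on $M$, $J$ is $\omega$-compatible if $\omega(u,Ju)>0$ for all nonzero tangent vectors $u$ and $\omega(u,Jv)=\omega(v,Ju)$ for all tangent vectors $u,v$ at the same point. Then $g$, determined by $\omega=g(J\cdot,\cdot)$, is a $J$-invariant Riemannian metric, and $(M,J,g,\omega)$ is an almost Kähler manifold. $J$ induces the bigrading of complex-valued forms $\mathcal A^r(M)=\bigoplus_{p+q=r}\mathcal A^{p,q}(M)$, and the exterior derivative decomposes as $d=\mu+\partial+\bar\partial+\bar\mu$, with components of bidegree $|\mu|=(2,-1)$, $|\partial|=(1,0)$, $|\bar\partial|=(0,1)$, $|\bar\mu|=(-1,2)$. For $\delta\in\{\mu,\partial,\bar\partial,\bar\mu,d\}$,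 $\delta^*$ is the formal $L^2$-adjoint with respect to $g$, $\Delta_\delta=\delta\delta^*+\delta^*\delta$, and $\mathcal H^{p,q}_\delta=\ker(\Delta_\delta)\cap\mathcal A^{p,q}$. The generalized Hodge numbers are $\ell^{p,q}=\dim_{\mathbb C}\big(\mathcal H^{p,q}_{\bar\partial}\cap\mathcal H^{p,q}_\mu\big)$. The Dolbeault cohomology of $(M,J)$ is $$H^{p,q}_{Dol}=\frac{\ker(\bar\partial:H^{p,q}_{\bar\mu}\to H^{p,q+1}_{\bar\mu})}{\operatorname{im}(\bar\partial:H^{p,q-1}_{\bar\mu}\to H^{p,q}_{\bar\mu})},\qquad H^{p,q}_{\bar\mu}=\frac{\ker(\bar\mu:\mathcal A^{p,q}\to\mathcal A^{p-1,q+2})}{\operatorname{im}(\bar\mu:\mathcal A^{p+1,q-2}\to\mathcal A^{p,q})},$$ and $h^{p,q}=\dim_{\mathbb C}H^{p,q}_{Dol}$. (In particular $H^{1,0}_{Dol}=\ker\bar\partial\cap\ker\bar\mu\cap\mathcal A^{1,0}$.) *)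

(* Defs.v *)
From mathcomp Require Import all_boot all_order all_algebra.
From mathcomp Require Import all_classical all_reals all_analysis.
From mathcomp Require Import complex.
Set Implicit Arguments.
Unset Strict Implicit.
Unset Printing Implicit Defensive.
Import Order.TTheory GRing.Theory Num.Theory.
Import numFieldNormedType.Exports.
Local Open Scope classical_set_scope.
Local Open Scope ring_scope.
Local Open Scope complex_scope.

(** The torus is T^N = R^N / Z^N; functions on it are Z^N-periodic functions on
    R^N, and its tangent bundle is trivialised by the coordinate fields.  The
    coordinates are numbered 0, .., N-1. *)

Definition evec (R : realType) (N : nat) (i : 'I_N) : 'rV[R]_N := delta_mx 0 i.

Definition periodic (R : realType) (N : nat) (T : Type) (f : 'rV[R]_N -> T) :
    Prop :=
  forall (i : 'I_N) (x : 'rV[R]_N), f (x + evec R i) = f x.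

Fixpoint C_k (R : realType) (N : nat) (k : nat) (f : 'rV[R]_N -> R) : Prop :=
  match k with
  | 0 => continuous f
  | k'.+1 => continuous f /\ forall i : 'I_N,
      (forall x, derivable f x (evec R i)) /\
      C_k k' (fun x => 'D_(evec R i) f x)
  end.

Definition smooth (R : realType) (N : nat) (f : 'rV[R]_N -> R) : Prop :=
  forall k : nat, C_k k f.

Definition smoothC (R : realType) (N : nat) (f : 'rV[R]_N -> R[i]) : Prop :=
  smooth (fun x => complex.Re (f x)) /\ smooth (fun x => complex.Im (f x)).

Definition partialC (R : realType) (N : nat) (i : 'I_N) (f : 'rV[R]_N -> R[i])
    (x : 'rV[R]_N) : R[i] :=
  'D_(evec R i) (fun y => complex.Re (f y)) x
  +i* 'D_(evec R i) (fun y => complex.Im (f y)) x.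

(** An element [a] of the complexified exterior algebra of (R^N)^* is the family
    of its coefficients: a = \sum_I a I dx^I, where dx^I is the wedge product of
    the dx^i, i \in I, taken in increasing order. *)
Definition ext (R : realType) (N : nat) : Type :=
  {ffun {set 'I_N} -> (R[i])^o}.

Definition form (R : realType) (N : nat) : Type := 'rV[R]_N -> ext R N.


Definition smooth_form (R : realType) (N : nat) (al : form R N) : Prop :=
  periodic al /\ forall I : {set 'I_N}, smoothC (fun x => al x I).

Definition wedge_sign (R : realType) (N : nat) (I K : {set 'I_N}) : R[i] :=
  (-1) ^+ #|[set p in finset.setX I K | (p.2 < p.1)%N]|.

Definition wedge (R : realType) (N : nat) (a b : ext R N) : ext R N :=
  [ffun K : {set 'I_N} => \sum_(S : {set 'I_N} | S \subset K)
     wedge_sign R S (K :\: S)%SET * a S * b (K :\: S)%SET].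

Definition ext_one (R : realType) (N : nat) : ext R N :=
  [ffun K : {set 'I_N} => (K == finset.set0)%:R].

(** The covector \sum_j w j dx^j. *)
Definition covector (R : realType) (N : nat) (w : 'I_N -> R[i]) : ext R N :=
  [ffun K : {set 'I_N} => \sum_(j | K == [set j]%SET) w j].

(** The wedge product of the covectors w i, i \in I, in increasing order of i. *)
Definition wedge_over (R : realType) (N : nat) (w : 'I_N -> 'I_N -> R[i])
    (I : {set 'I_N}) : ext R N :=
  foldr (fun i a => wedge (covector (w i)) a) (ext_one R N) (enum I).

Definition is_degree (R : realType) (N : nat) (r : int) (al : form R N) : Prop :=
  smooth_form al /\
  forall (x : 'rV[R]_N) (I : {set 'I_N}), #|I|%:Z != r -> al x I = 0.

Definition ext_d (R : realType) (N : nat) (al : form R N) : form R N :=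
  fun x => [ffun K : {set 'I_N} => \sum_(i in K)
    (-1) ^+ #|[set j in K | (j < i)%N]|
    * partialC i (fun y => al y (K :\ i)%SET) x].

(** J x is the matrix of the almost complex structure at x acting on column
    vectors.  Covectors of type (1,0) satisfy t \o J = 'i t, so the (1,0) and
    (0,1) components of dx^i are (dx^i -+ 'i dx^i \o J) / 2. *)
Definition dx10 (R : realType) (N : nat) (J : 'M[R]_N) (i j : 'I_N) : R[i] :=
  ((i == j)%:R - 'i%C * (J i j)%:C) / 2%:R.

Definition dx01 (R : realType) (N : nat) (J : 'M[R]_N) (i j : 'I_N) : R[i] :=
  ((i == j)%:R + 'i%C * (J i j)%:C) / 2%:R.

(** Projection onto bidegree (p, q): substitute dx^i = (dx^i)^{1,0} +
    (dx^i)^{0,1} in a = \sum_I a I dx^I, expand, and keep the products of p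
    factors of type (1,0) and q factors of type (0,1). *)
Definition type_proj (R : realType) (N : nat) (J : 'M[R]_N) (p q : int)
    (a : ext R N) : ext R N :=
  \sum_(I : {set 'I_N}) (a I : R[i]) *:
    \sum_(S : {set 'I_N} | [&& S \subset I, #|S|%:Z == p
                             & #|(I :\: S)%SET|%:Z == q])
      wedge_over (fun i => if i \in S then dx10 J i else dx01 J i) I.

Definition form_proj (R : realType) (N : nat) (J : 'rV[R]_N -> 'M[R]_N)
    (p q : int) (al : form R N) : form R N :=
  fun x => type_proj (J x) p q (al x).

Definition is_type (R : realType) (N : nat) (J : 'rV[R]_N -> 'M[R]_N)
    (p q : int) (al : form R N) : Prop :=
  smooth_form al /\ form_proj J p q al = al.

(** The component of bidegree (a, b) of the exterior derivative. *)
Definition d_component (R : realType) (N : nat) (J : 'rV[R]_N -> 'M[R]_N)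
    (a b : int) (al : form R N) : form R N :=
  \sum_(p < N.+1) \sum_(q < N.+1)
    form_proj J (p%:Z + a) (q%:Z + b) (ext_d (form_proj J p%:Z q%:Z al)).

Definition d_mu (R : realType) (N : nat) (J : 'rV[R]_N -> 'M[R]_N) :=
  d_component J 2 (-1).
Definition d_del (R : realType) (N : nat) (J : 'rV[R]_N -> 'M[R]_N) :=
  d_component J 1 0.
Definition d_delbar (R : realType) (N : nat) (J : 'rV[R]_N -> 'M[R]_N) :=
  d_component J 0 1.
Definition d_mubar (R : realType) (N : nat) (J : 'rV[R]_N -> 'M[R]_N) :=
  d_component J (-1) 2.

(** The matrix of omega_0 = dx^0 /\ dx^1 + dx^2 /\ dx^3 + .. : omega_0 (u, v) is
    u^T *m omega0 R N *m v for column vectors u and v. *)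
Definition omega0 (R : realType) (N : nat) : 'M[R]_N :=
  \matrix_(i, j) ((~~ odd i && (j == i.+1 :> nat))%:R
                  - (odd i && (i == j.+1 :> nat))%:R).

Definition omega0_form (R : realType) (N : nat) (u v : 'cV[R]_N) : R :=
  (u^T *m omega0 R N *m v) 0 0.

Definition almost_complex (R : realType) (N : nat)
    (J : 'rV[R]_N -> 'M[R]_N) : Prop :=
  [/\ periodic J, forall i j : 'I_N, smooth (fun x => J x i j)
    & forall x, J x *m J x = - 1%:M].

Definition omega0_compatible (R : realType) (N : nat)
    (J : 'rV[R]_N -> 'M[R]_N) : Prop :=
  [/\ almost_complex J,
      forall x (u : 'cV[R]_N), u != 0 -> 0 < omega0_form u (J x *m u)
    & forall x (u v : 'cV[R]_N),
        omega0_form u (J x *m v) = omega0_form v (J x *m u)].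

(** omega_0 = g (J _, _) amounts to g (u, v) = - omega_0 (J u, v)
    = omega_0 (v, J u) = omega_0 (u, J v) when J is compatible. *)
Definition metric (R : realType) (N : nat) (J : 'M[R]_N) : 'M[R]_N :=
  omega0 R N *m J.

(** The Hermitian inner product induced by the metric on the exterior algebra:
    <dx^I, dx^K> is the minor of the inverse metric on rows I and columns K,
    i.e. the coefficient at dx^K of the wedge product over i \in I of the
    \sum_j (g^-1)_ij dx^j. *)
Definition ext_inner (R : realType) (N : nat) (J : 'M[R]_N) (a b : ext R N) :
    R[i] :=
  \sum_(I : {set 'I_N}) \sum_(K : {set 'I_N})
    (a I : R[i]) * conjc (b K : R[i])
    * wedge_over (fun i j => (invmx (metric J) i j)%:C) I K.

(** Iterated integral over [0, 1]^N, a fundamental domain of the torus. *)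
Fixpoint cube_integral (R : realType) (N : nat) : ('rV[R]_N -> R) -> R :=
  match N with
  | 0 => fun f => f 0
  | N'.+1 => fun f =>
      Rintegral (@lebesgue_measure R) `[0, 1]
        (fun t : R => cube_integral (fun y : 'rV[R]_N' =>
           f (row_mx (t%:M : 'rV[R]_1) y : 'rV[R]_(1 + N'))))
  end.

Definition L2_inner (R : realType) (N : nat) (J : 'rV[R]_N -> 'M[R]_N)
    (al be : form R N) : R[i] :=
  let h x := ext_inner (J x) (al x) (be x) in
  let vol x := Num.sqrt (\det (metric (J x))) in
  cube_integral (fun x => complex.Re (h x) * vol x)
  +i* cube_integral (fun x => complex.Im (h x) * vol x).

(** The graph of the formal L^2-adjoint of dl: dl^* al = be. *)
Definition is_adjoint_value (R : realType) (N : nat) (J : 'rV[R]_N -> 'M[R]_N)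
    (dl : form R N -> form R N) (al be : form R N) : Prop :=
  smooth_form be /\
  forall ga, smooth_form ga -> L2_inner J (dl ga) al = L2_inner J ga be.

(** The graph of the Laplacian dl dl^* + dl^* dl. *)
Definition is_laplacian_value (R : realType) (N : nat)
    (J : 'rV[R]_N -> 'M[R]_N) (dl : form R N -> form R N)
    (al la : form R N) : Prop :=
  exists be ga : form R N,
    [/\ is_adjoint_value J dl al be, is_adjoint_value J dl (dl al) ga
      & la = dl be + ga].

Definition harmonic (R : realType) (N : nat) (J : 'rV[R]_N -> 'M[R]_N)
    (dl : form R N -> form R N) (p q : int) : set (form R N) :=
  [set al | is_type J p q al /\ is_laplacian_value J dl al 0].

(** The subquotient sq_num / sq_den of the space of forms. *)
Record subquotient (R : realType) (N : nat) := Subquotient {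
  sq_num : set (form R N);
  sq_den : set (form R N) }.

(** ker (Y -> Z) / im (X -> Y) for the maps induced by [f] on subquotients. *)
Definition sq_cohomology (R : realType) (N : nat) (f : form R N -> form R N)
    (X Y Z : subquotient R N) : subquotient R N :=
  Subquotient
    [set al | sq_num Y al /\ sq_den Z (f al)]
    [set al | exists be ga : form R N,
       [/\ sq_num X be, sq_den Y ga & al = f be + ga]].

(** Dimension over the complex numbers: the supremum of the sizes of the families
    of [sq_num X] that are linearly independent modulo [sq_den X]. *)
Definition sq_dim (R : realType) (N : nat) (X : subquotient R N) : \bar R :=
  ereal_sup [set (k%:R)%:E | k in [set k : nat |
    exists v : 'I_k -> form R N, (forall i, sq_num X (v i)) /\
      forall c : 'I_k -> R[i],
        sq_den X (\sum_(i < k) c i *: v i) -> forall i, c i = 0]].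

Definition A_degree (R : realType) (N : nat) (r : int) : subquotient R N :=
  Subquotient (is_degree r) [set 0].

Definition A_type (R : realType) (N : nat) (J : 'rV[R]_N -> 'M[R]_N)
    (p q : int) : subquotient R N :=
  Subquotient (is_type J p q) [set 0].

Definition betti (R : realType) (N : nat) (r : int) : \bar R :=
  sq_dim (sq_cohomology (@ext_d R N)
    (A_degree R N (r - 1)) (A_degree R N r) (A_degree R N (r + 1))).

Definition H_mubar (R : realType) (N : nat) (J : 'rV[R]_N -> 'M[R]_N)
    (p q : int) : subquotient R N :=
  sq_cohomology (d_mubar J)
    (A_type J (p + 1) (q - 2)) (A_type J p q) (A_type J (p - 1) (q + 2)).

Definition H_Dol (R : realType) (N : nat) (J : 'rV[R]_N -> 'M[R]_N)
    (p q : int) : subquotient R N :=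
  sq_cohomology (d_delbar J)
    (H_mubar J p (q - 1)) (H_mubar J p q) (H_mubar J p (q + 1)).

Definition h_Dol (R : realType) (N : nat) (J : 'rV[R]_N -> 'M[R]_N)
    (p q : int) : \bar R :=
  sq_dim (H_Dol J p q).

Definition ell (R : realType) (N : nat) (J : 'rV[R]_N -> 'M[R]_N)
    (p q : int) : \bar R :=
  sq_dim (Subquotient
    (harmonic J (d_delbar J) p q `&` harmonic J (d_mu J) p q) [set 0]).

(* Main.v *)
(** Take J = - omega_0 D with D = diag (g_i), g_i = exp (s_i cos (2 pi x_0)), where
    the real numbers s_i satisfy s_{j+1} = - s_j for j even and s_0 = 0.  Then J is
    compatible with metric D, and the (1,0)-forms are spanned by g_j dx^j + i dx^{j+1},
    j even.  If b_j is the coefficient of dx^{j+1} in a (1,0)-form alpha, then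
    delbar alpha = 0 says that
      2 g_j (d_l + i g_l d_{l+1}) b_j = (d_j g_l) b_l - (d_l g_j) b_j   (j, l even).
    As g_l only depends on x_0, these are Cauchy-Riemann equations in the plane of
    (x_l, x_{l+1}); Liouville's theorem for periodic functions, applied first for
    j, l <> 0, then j = 0, then l = 0, shows that every b_j is constant and that
    b_j = 0 unless s_j = 0.  So the solutions have one dimension for each pair
    (j, j+1) with s_j = 0.

    In bidegree (1,0) the operators mu, delbar^* and mu^* vanish for reasons of type,
    so both h^{1,0} and l^{1,0} count these solutions: conversely they are closed, so
    they lie in ker mubar, and <Delta alpha, alpha> = 0 gives delbar alpha = 0 for
    harmonic alpha.  Liouville's theorem is proved by the maximum principle for
    u_j ^ 2 + eps u ^ 2, without integration. *)

From HB Require Import structures.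
Require Import Defs.
From mathcomp Require Import all_boot all_order all_algebra.
From mathcomp Require Import all_classical all_reals all_analysis.
From mathcomp Require Import complex zify ring lra.
Set Implicit Arguments.
Unset Strict Implicit.
Unset Printing Implicit Defensive.
Import Order.TTheory GRing.Theory Num.Theory.
Import numFieldNormedType.Exports.
Local Open Scope classical_set_scope.
Local Open Scope ring_scope.

(** The relation [s_{j+1} = - s_j] gives [g_j g_{j+1} = 1], hence [J ^ 2 = - 1] and a metric of
    determinant one, so that no volume density remains in the L2 product. The pair containing [x_0]
    is kept flat ([s_0 = 0]) because the Liouville argument differentiates the Cauchy-Riemann system
    along its plane and needs a coefficient that is constant there. The obstacle is the right-hand
    side, which couples the coefficients. It vanishes outright for [j, l <> 0]. For [j = 0] it is
    [(d_0 g_l) b_l], which the previous case shows to be constant along the plane of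
    [(x_l, x_{l+1})]; periodicity of the solution then forces it to be zero. This removes the
    right-hand side [- (d_0 g_j) b_j] for [l = 0], and it also forces [b_l = 0] when [s_l <> 0], as
    [d_0 g_l] is not identically zero and [b_l] is constant. Twisting [k] of the [n + 1] pairs thus
    leaves dimension [n - k + 1], and [k = 1] already gives [2 n < 2 n + 2]. The size of the nonzero
    [s_j] stays free, whence infinitely many structures. *)

Local Notation periodic := Defs.periodic.
Local Notation form := Defs.form.

(** * Calculus on the torus *)

Section Lines.
Variables (R : realType) (V : normedModType R).
Implicit Types (f : V -> R) (x v : V).

Lemma is_derive_line f x v (t : R) : derivable f (t *: v + x) v ->
  is_derive t 1 (fun s => f (s *: v + x)) ('D_v f (t *: v + x)).
Proof.
move=> df.
have E : (fun h : R => h^-1 *: (((fun s => f (s *: v + x)) \o shift t) (h *: 1)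
     - f (t *: v + x)))
   = (fun h : R => h^-1 *: ((f \o shift (t *: v + x)) (h *: v) - f (t *: v + x))).
  apply/funext => h /=; congr (_ *: (f _ - _)).
  by rewrite -[h%:A]/(h * 1) mulr1 scalerDl addrA.
split; first by rewrite /derivable E.
by rewrite /derive E.
Qed.

Lemma continuous_line f x v : continuous f ->
  continuous (fun s : R => f (s *: v + x)).
Proof.
move=> cf t; apply: (continuous_comp (f := fun s : R => s *: v + x)).
  apply: cvgD; last exact: cvg_cst.
  exact: scalel_continuous.
exact: cf.
Qed.

Lemma MVT_line f x v (t : R) : (forall y, derivable f y v) -> continuous f ->
  0 < t -> exists2 c, 0 < c < t & f (t *: v + x) - f x = t * 'D_v f (c *: v + x).
Proof.
move=> df cf t0.
have [||c ct] := @MVT R (fun s => f (s *: v + x))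
    (fun s => 'D_v f (s *: v + x)) 0 t t0.
- by move=> s _; exact: is_derive_line.
- exact/continuous_subspaceT/continuous_line.
rewrite scale0r add0r subr0 mulrC => ->; exists c => //.
Qed.

(** Were the second derivative positive, the first one, zero at [p], would be positive just beyond
    [p], and the mean value theorem would give a larger value of [f]. *)
Lemma second_derivative_at_max f p v :
  (forall y, derivable f y v) -> continuous f ->
  (forall y, derivable ('D_v f) y v) ->
  (forall y, f y <= f p) -> 'D_v f p = 0 /\ 'D_v ('D_v f) p <= 0.
Proof.
move=> df cf ddf fmax.
have D0 : 'D_v f p = 0.
  have H1 : is_derive (0:R) 1 (fun s => f (s *: v + p)) 0.
    apply: (@derive1_at_max R _ (-1) 1 0) => //.
    - by move=> t _; exact: (@ex_derive _ _ _ _ _ _ _ (is_derive_line (df _))).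
    - by rewrite in_itv/= ltrN10 ltr01.
    - by move=> t _; rewrite scale0r add0r.
  have H2 := is_derive_line (df (0 *: v + p)).
  have := derive_val (is_derive := H2).
  by rewrite (derive_val (is_derive := H1)) scale0r add0r => <-.
split => //; rewrite leNgt; apply/negP => Dpos.
have H2 : is_derive (0:R) 1 (fun s => 'D_v f (s *: v + p)) ('D_v ('D_v f) p).
  have := is_derive_line (ddf (0 *: v + p)).
  by rewrite scale0r add0r.
have [d d0 Hd] : exists2 d : R, 0 < d & forall h, 0 < h < d -> 0 < 'D_v f (h *: v + p).
  have [d /= d0 Hd] : nbhs (0:R)^' [set h : R | 0 < h^-1 * ('D_v f (h *: v + p))].
    have C := ex_derive (is_derive := H2).
    have L := derive_val (is_derive := H2).
    rewrite /derivable in C; move/cvg_ex: C => [l Cl].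
    have ll : l = 'D_v ('D_v f) p by rewrite -L; apply/esym/(cvg_lim _ Cl).
    rewrite ll in Cl.
        apply: filterS (cvgr_gt _ Cl _ Dpos) => h /=.
    by rewrite scale0r add0r addr0 D0 subr0 -[h%:A]/(h * 1) mulr1.
  exists d => // h /andP[h0 hd].
  have := Hd h; rewrite /= sub0r normrN gtr0_norm// gt_eqF// => /(_ hd isT).
  by rewrite pmulr_rgt0 ?invr_gt0.
have d20 : 0 < d / 2 by lra.
have [c cd E] := MVT_line p df cf d20.
have := fmax (d / 2 *: v + p); rewrite -subr_le0 E leNgt mulr_gt0//.
by apply: Hd; lra.
Qed.

End Lines.

(** * Smooth functions and the symmetry of mixed derivatives *)

Section SmoothFunctions.
Variables (R : realType) (N : nat).
Local Notation vec := 'rV[R]_N.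
Local Notation e := (evec R).
Implicit Types (f g u : vec -> R) (i j : 'I_N) (x y : vec).

Lemma smooth_continuous f : smooth f -> continuous f.
Proof. by move/(_ 0%N). Qed.

Lemma smooth_derivable f i x : smooth f -> derivable f x (e i).
Proof. by move/(_ 1%N) => [_ /(_ i)[]]. Qed.

Arguments smooth_continuous [f] _.
Arguments smooth_derivable [f] i x _.

Lemma smooth_D f i : smooth f -> smooth ('D_(e i) f).
Proof. by move=> sf k; have [_ /(_ i)[]] := sf k.+1. Qed.

Lemma C_kS k f : C_k k.+1 f -> C_k k f.
Proof.
elim: k f => [|k IH] f [cf H] //; split => // i.
by have [df Hf] := H i; split => //; exact: IH.
Qed.

Lemma C_k_cst k (c : R) : C_k k (fun _ : vec => c).
Proof.
elim: k c => [|k IH] c; first by move=> x; exact: cst_continuous.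
split=> [|i]; first by move=> x; exact: cst_continuous.
split=> [x|]; first exact: derivable_cst.
have -> : (fun x => 'D_(e i) (fun _ : vec => c) x) = fun=> 0.
  by apply/funext => x; rewrite derive_cst.
exact: IH.
Qed.

Lemma C_kD k f g : C_k k f -> C_k k g -> C_k k (f + g).
Proof.
elim: k f g => [|k IH] f g; first by move=> /= cf cg x; exact: (continuousD (cf x) (cg x)).
move=> [cf Hf] [cg Hg]; split=> [x|i]; first by exact: (continuousD (cf x) (cg x)).
have [df Df] := Hf i; have [dg Dg] := Hg i; split=> [x|]; first exact: derivableD.
have -> : (fun x => 'D_(e i) (f + g) x) = 'D_(e i) f + 'D_(e i) g.
  by apply/funext => x; rewrite deriveD.
exact: IH.
Qed.

Lemma C_kM k f g : C_k k f -> C_k k g -> C_k k (f * g).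
Proof.
elim: k f g => [|k IH] f g; first by move=> /= cf cg x; exact: (continuousM (cf x) (cg x)).
move=> Cf Cg; have [cf Hf] := Cf; have [cg Hg] := Cg.
split=> [x|i]; first by exact: (continuousM (cf x) (cg x)).
have [df Df] := Hf i; have [dg Dg] := Hg i; split=> [x|]; first exact: derivableM.
have -> : (fun x => 'D_(e i) (f * g) x) = f * 'D_(e i) g + g * 'D_(e i) f.
  by apply/funext => x; rewrite deriveM.
by apply: C_kD; apply: IH => //; exact: C_kS.
Qed.

Lemma smooth_cst (c : R) : smooth (fun _ : vec => c).
Proof. by move=> k; exact: C_k_cst. Qed.

Lemma smoothD f g : smooth f -> smooth g -> smooth (f + g).
Proof. by move=> sf sg k; exact: C_kD. Qed.

Lemma smoothM f g : smooth f -> smooth g -> smooth (f * g).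
Proof. by move=> sf sg k; exact: C_kM. Qed.

(** The mean value theorem, applied to the increment in direction [j] and then to the derivative
    along [i], evaluates a second difference. That difference is symmetric in [i] and [j], and the
    symmetry of mixed derivatives rests on this. *)
Lemma deriv_pair f i j x (h : R) : smooth f -> 0 < h ->
  exists2 p, 0 < p.1 < h /\ 0 < p.2 < h &
    f (h *: e j + (h *: e i + x)) - f (h *: e i + x)
      - (f (h *: e j + x) - f x)
    = h * (h * 'D_(e j) ('D_(e i) f) (p.2 *: e j + (p.1 *: e i + x))).
Proof.
move=> sf h0.
pose g y := f (h *: e j + y) - f y.
have shE v y : (fun h' : R => h'^-1 *: (((fun y => f (v + y)) \o shift y) (h' *: e i) - f (v + y)))
   = (fun h' => h'^-1 *: ((f \o shift (v + y)) (h' *: e i) - f (v + y))).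
  by apply/funext => h' /=; rewrite addrCA.
have dsh v y : derivable (fun y => f (v + y)) y (e i).
  by rewrite /derivable shE; exact: smooth_derivable.
have Dsh v y : 'D_(e i) (fun y => f (v + y)) y = 'D_(e i) f (v + y).
  by rewrite /derive shE.
have dg y : derivable g y (e i).
  by apply: derivableB; [exact: dsh|exact: smooth_derivable].
have cg : continuous g.
  have c1 : continuous (fun z => f (h *: e j + z)).
    move=> z; apply: (@continuous_comp _ _ _ (fun z => h *: e j + z) f).
      by apply: continuousD; [exact: cst_continuous|exact: cvg_id].
    exact: smooth_continuous.
  move=> y; have := (continuousB (c1 y) (@smooth_continuous f sf y)); exact.
have [s sh Es] := MVT_line x dg cg h0.
have sDf := smooth_D i sf.
have [t th Et] := MVT_line (s *: e i + x) (fun y => smooth_derivable j y sDf)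
  (smooth_continuous sDf) h0.
exists (s, t) => //.
transitivity (g (h *: e i + x) - g x); first by [].
rewrite Es deriveB ?Dsh//=; last exact: smooth_derivable.
by rewrite Et.
Qed.

Lemma deriv_comm f i j x : smooth f ->
  'D_(e i) ('D_(e j) f) x = 'D_(e j) ('D_(e i) f) x.
Proof.
move=> sf.
(* The mean value points are not under control, so continuity of the mixed derivative is used in
   both step sizes at once. *)
have key i' j' (eps : R) : 0 < eps -> \forall h \near 0^'+, forall s t : R,
    0 < s < h -> 0 < t < h ->
    `|'D_(e j') ('D_(e i') f) x
      - 'D_(e j') ('D_(e i') f) (t *: e j' + (s *: e i' + x))| < eps.
  move=> eps0; pose F := 'D_(e j') ('D_(e i') f).
  have cF : {for 0, continuous (fun p : R * R => F (p.2 *: e j' + (p.1 *: e i' + x)))}.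
    apply: (@continuous_comp _ _ _ (fun p : R * R => p.2 *: e j' + (p.1 *: e i' + x)) F).
      apply: cvgD; first by apply: cvgZr_tmp; exact: cvg_snd.
      by apply: cvgD; [apply: cvgZr_tmp; exact: cvg_fst|exact: cvg_cst].
    by apply: smooth_continuous; do 2!apply: smooth_D.
  move/cvgrPdist_lt : cF => /(_ _ eps0).
  rewrite /= scale0r add0r scale0r add0r => -[[A B] /= [[a /= a0 Aa] [b /= b0 Bb]] AB].
  near=> h => s t /andP[s0 sh] /andP[t0 th].
  apply: (AB (s, t)); split => /=.
    by apply: Aa; rewrite /= sub0r normrN gtr0_norm// (lt_trans sh).
  by apply: Bb; rewrite /= sub0r normrN gtr0_norm// (lt_trans th).
apply/eqP; rewrite eq_sym -subr_eq0 -normr_le0; apply/ler_addgt0Pl => eps eps0.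
rewrite addr0; have e2 : 0 < eps / 2 by lra.
have [h [h0 [H1 H2]]] := filter_ex
  (filterI (nbhs_right_gt (0 : R)) (filterI (key i j _ e2) (key j i _ e2))).
have [[s t] /= [sh th] E1] := deriv_pair i j x sf h0.
have [[s' t'] /= [sh' th'] E2] := deriv_pair j i x sf h0.
(* Both orders compute the same second difference; cancelling [h] twice identifies the two mixed
   derivatives at nearby points. *)
have E : 'D_(e j) ('D_(e i) f) (t *: e j + (s *: e i + x))
       = 'D_(e i) ('D_(e j) f) (t' *: e i + (s' *: e j + x)).
  apply: (mulfI (lt0r_neq0 h0)); apply: (mulfI (lt0r_neq0 h0)).
  apply: (etrans (esym E1) (etrans _ E2)); rewrite [in LHS]addrCA.
  by move: (f _) (f _) (f _) (f _) => a b c d; ring.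
have h1 := H1 s t sh th; have h2 := H2 s' t' sh' th'; rewrite E in h1.
clear -h1 h2; set a := 'D_(e j) ('D_(e i) f) x in h1 *.
set b := 'D_(e i) ('D_(e j) f) x in h2 *.
set c := 'D_(e i) _ _ in h1 h2; move: a b c h1 h2 => a b c h1 h2.
have -> : a - b = (a - c) - (b - c) by rewrite opprB addrA subrK.
by rewrite (le_trans (ler_normB _ _))// (splitr eps) lerD// ltW.
Unshelve. all: by end_near.
Qed.
End SmoothFunctions.
Arguments smooth_continuous [R N f] _.
Arguments smooth_derivable [R N f] i x _.
Arguments smooth_D [R N f] i _.

(* Locked: unification would otherwise unfold ['D_v f] down to filters. *)
HB.lock Definition pd (R : realType) (N : nat) (i : 'I_N) (f : 'rV[R]_N -> R) :
  'rV[R]_N -> R := 'D_(evec R i) f.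
Canonical pd_unlockable := Unlockable pd.unlock.

(** * The maximum principle for periodic functions *)

Section MaximumPrinciple.
Variables (R : realType) (N : nat).
Local Notation vec := 'rV[R]_N.
Local Notation e := (evec R).
Implicit Types (f g u v : vec -> R) (i j : 'I_N) (x y : vec).

Definition unit_cube : set vec := [set x | forall i, 0 <= x 0 i <= 1].

Lemma unit_cube_compact : compact unit_cube.
Proof.
have := @rV_compact R N (fun=> `[0, 1]%classic) (fun=> @segment_compact R 0 1).
by congr compact; apply/seteqP; split => x /= H i; have := H i; rewrite /= in_itv.
Qed.

Lemma row_sum_evec x : x = \sum_i x 0 i *: e i.
Proof. exact: row_sum_delta. Qed.

Lemma periodic_int (T : Type) (f : vec -> T) i (m : int) x :
  periodic f -> f (m%:~R *: e i + x) = f x.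
Proof.
move=> pf; have P (k : nat) y : f (k%:R *: e i + y) = f y.
  elim: k y => [|k IH] y; first by rewrite scale0r add0r.
  by rewrite -natr1 scalerDl scale1r -addrA IH addrC pf.
case: m => k; first by rewrite -pmulrn P.
by rewrite NegzE mulrNz -pmulrn scaleNr -[in RHS](subrK (k.+1%:R *: e i) x) [in RHS]addrC P addrC.
Qed.

(** The witness is the vector of fractional parts. It is chosen before [f], so that one point serves
    functions with values in any type, forms included. *)
Lemma periodic_reduce x : exists2 y, unit_cube y &
  forall (T : Type) (f : vec -> T), periodic f -> f x = f y.
Proof.
pose z := \sum_i (Num.floor (x 0 i))%:~R *: e i.
exists (x - z).
  move=> i; rewrite !mxE /z summxE (bigD1 i)//= big1 ?addr0 => [|j ji].
    have /andP[fl fr] := floor_itv (x 0 i); rewrite intrD in fr.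
    by rewrite !mxE !eqxx mulr1 subr_ge0 fl lerBlDl ltW.
  by rewrite !mxE eq_sym (negbTE ji) andbF mulr0.
move=> T f pf; rewrite /z.
elim/big_rec: _ => [|i z' _ ->]; first by rewrite subr0.
by rewrite -(periodic_int i (- Num.floor (x 0 i)) _ pf) mulrNz scaleNr opprD addrCA.
Qed.

Lemma periodic_max f : periodic f -> continuous f -> exists p, forall x, f x <= f p.
Proof.
move=> pf cf.
have c0 : unit_cube !=set0 by exists 0 => i; rewrite mxE lexx ler01.
have [p _ Hp] := EVT_max_rV c0 unit_cube_compact (continuous_subspaceT cf).
exists p => x; have [y Cy ->//] := periodic_reduce x.
by apply: Hp; rewrite inE.
Qed.

Lemma pdE i f : pd i f = 'D_(e i) f.
Proof. by rewrite unlock. Qed.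

Lemma periodic_pd f i : periodic f -> periodic (pd i f).
Proof.
move=> pf j x; rewrite pdE /derive.
suff -> : (fun h => h^-1 *: ((f \o shift (x + e j)) (h *: e i) - f (x + e j)))
  = (fun h => h^-1 *: ((f \o shift x) (h *: e i) - f x)) by [].
by apply/funext => h /=; rewrite addrA !pf.
Qed.

Lemma smooth_pd f i : smooth f -> smooth (pd i f).
Proof. by rewrite pdE; exact: smooth_D. Qed.

Lemma pd_comm f i j : smooth f -> pd i (pd j f) = pd j (pd i f).
Proof. by move=> sf; rewrite !pdE; apply/funext => y; exact: deriv_comm. Qed.

Lemma pdD f g i x : derivable f x (e i) -> derivable g x (e i) ->
  pd i (f + g) x = pd i f x + pd i g x.
Proof. by rewrite !pdE; exact: deriveD. Qed.

Lemma pdM f g i x : derivable f x (e i) -> derivable g x (e i) ->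
  pd i (f * g) x = f x * pd i g x + g x * pd i f x.
Proof. by rewrite !pdE; exact: deriveM. Qed.

Lemma pd_cst (c : R) i x : pd i (fun=> c) x = 0.
Proof. by rewrite pdE; exact: derive_cst. Qed.

(** Only derivatives along the axes are given, so [x] is joined to [0] one coordinate at a time. *)
Lemma const_of_D0 f : (forall i x, is_derive x (e i) f 0) -> forall x y, f x = f y.
Proof.
move=> Df; suff H x : f x = f 0 by move=> x y; rewrite H (H y).
rewrite (row_sum_evec x).
elim/big_rec: _ => // i z _ <-.
have := @is_derive_0_is_cst R (fun s => f (s *: e i + z)) (x 0 i) 0.
rewrite scale0r add0r; apply => t.
apply: is_derive_eq; first exact: (is_derive_line (ex_derive (is_derive := Df i _))).
exact: (derive_val (is_derive := Df i _)).
Qed.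

Lemma pd_add f g i : smooth f -> smooth g -> pd i (f + g) = pd i f + pd i g.
Proof.
by move=> sf sg; apply/funext => x; apply: pdD; exact: smooth_derivable.
Qed.

Lemma pd_mul f g i : smooth f -> smooth g ->
  pd i (f * g) = f * pd i g + g * pd i f.
Proof.
by move=> sf sg; apply/funext => x; apply: pdM; exact: smooth_derivable.
Qed.

Lemma pd2_mul f g i x : smooth f -> smooth g ->
  pd i (pd i (f * g)) x =
  f x * pd i (pd i g) x + g x * pd i (pd i f) x + 2 * (pd i f x * pd i g x).
Proof.
move=> sf sg; have sDf := smooth_pd i sf; have sDg := smooth_pd i sg.
rewrite (pd_mul i sf sg) (pd_add i (smoothM sf sDg) (smoothM sg sDf)).
rewrite (pd_mul i sf sDg) (pd_mul i sg sDf) !addrfctE !mulrfctE /=.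
move: (pd i f x) (pd i g x) (pd i (pd i f) x) (pd i (pd i g) x) (f x) (g x).
by move=> *; ring.
Qed.

Lemma pd2_square_sum u v (eps : R) i x : smooth u -> smooth v ->
  pd i (pd i (v * v + cst eps * (u * u))) x =
  2 * (pd i v x ^+ 2 + v x * pd i (pd i v) x)
  + 2 * eps * (pd i u x ^+ 2 + u x * pd i (pd i u) x).
Proof.
move=> su sv; have suu := smoothM su su; have svv := smoothM sv sv.
have sc := @smooth_cst R N eps.
have sce := smoothM sc suu.
rewrite (pd_add i svv sce) (pd_add i (smooth_pd i svv) (smooth_pd i sce)).
rewrite addrfctE (pd2_mul i x sv sv) (pd2_mul i x sc suu) (pd2_mul i x su su).
have -> : pd i (fun _ : vec => eps) = fun=> 0 by apply/funext => y; rewrite pd_cst.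
rewrite pd_cst mulrfctE /cst.
move: (pd i v x) (pd i u x) (pd i (pd i v) x) (pd i (pd i u) x) (v x) (u x).
by move=> *; ring.
Qed.

Lemma periodicD f g : periodic f -> periodic g -> periodic (f + g).
Proof. by move=> pf pg i x; rewrite !addrfctE pf pg. Qed.

Lemma periodicM f g : periodic f -> periodic g -> periodic (f * g).
Proof. by move=> pf pg i x; rewrite !mulrfctE pf pg. Qed.

(* At a maximum of [v ^ 2 + eps u ^ 2], with [v] a first derivative of [u],
   ellipticity forces [v = 0]; hence [v ^ 2 <= eps max u ^ 2] everywhere. *)
Lemma elliptic_vanish u i j (c : vec -> R) : smooth u -> periodic u ->
  (forall x, 0 < c x) ->
  (forall k, k \in [:: i; j] -> forall x, pd k c x = 0 /\ derivable c x (e k)) ->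
  (forall x, pd i (pd i u) x + c x * pd j (pd j u) x = 0) ->
  forall x, pd i u x = 0 /\ pd j u x = 0.
Proof.
move=> su pu c0 Dc Lu.
(* As [c] is constant in the directions [i] and [j], differentiating the equation along them shows
   that [v] solves it too. *)
have Lv k : k \in [:: i; j] -> forall x, let v := pd k u in
    pd i (pd i v) x + c x * pd j (pd j v) x = 0.
  move=> kij x /=.
  have swap l : pd l (pd l (pd k u)) = pd k (pd l (pd l u)).
    by rewrite (pd_comm l k su) (pd_comm l k (smooth_pd l su)).
  rewrite !swap; have [Dk dk] := Dc k kij x.
  have sii : smooth (pd i (pd i u)) by do 2!apply: smooth_pd.
  have sjj : smooth (pd j (pd j u)) by do 2!apply: smooth_pd.
  have d2 := smooth_derivable k x sjj.
  have : pd k (pd i (pd i u) + c * pd j (pd j u)) x = 0.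
    have -> : pd i (pd i u) + c * pd j (pd j u) = fun=> 0.
      by apply/funext => y; rewrite addrfctE mulrfctE Lu.
    exact: pd_cst.
  rewrite (pdD (smooth_derivable k x sii) (derivableM dk d2)) (pdM dk d2).
  by rewrite Dk mulr0 addr0.
have main k : k \in [:: i; j] -> forall x, pd k u x = 0.
  move=> kij x; pose v := pd k u.
  have sv : smooth v by exact: smooth_pd.
  have pv : periodic v by exact: periodic_pd.
  have [q Hq] := periodic_max (periodicM pu pu) (smooth_continuous (smoothM su su)).
  (* Letting [eps] tend to zero gives [v x = 0]; the [+ 1] makes the factor positive, so that it can
     be divided by. *)
  suff H (eps : R) : 0 < eps -> v x ^+ 2 <= eps * (u q * u q + 1).
    apply/eqP; rewrite -sqrf_eq0 eq_le sqr_ge0 andbT -/(v x).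
    have q0 : 0 < u q * u q + 1 by rewrite -expr2 ltr_pwDr// sqr_ge0.
    apply/ler_addgt0Pl => d d0; rewrite addr0.
    by have := H (d / (u q * u q + 1)); rewrite divfK ?gt_eqF//; apply; rewrite divr_gt0.
  move=> eps0; pose Phi := v * v + cst eps * (u * u).
  have sPhi : smooth Phi.
    by apply: smoothD; apply: smoothM => //; [exact: smooth_cst|exact: smoothM].
  have pPhi : periodic Phi.
    by apply: periodicD; apply: periodicM => //; exact: periodicM.
  have [p Hp] := periodic_max pPhi (smooth_continuous sPhi).
  have dDPhi l y : derivable ('D_(e l) Phi) y (e l).
    by rewrite -pdE; apply: smooth_derivable; exact: smooth_pd.
  have t l := second_derivative_at_max (fun y => smooth_derivable l y sPhi)
    (smooth_continuous sPhi) (dDPhi l) Hp.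
  have {}t l : pd l (pd l Phi) p <= 0 by have [_] := t l; rewrite !pdE.
  have ti := t i; rewrite /Phi (pd2_square_sum eps i p su sv) in ti.
  have tj := t j; rewrite /Phi (pd2_square_sum eps j p su sv) in tj.
  have v0 : v p = 0.
    have Hu := Lu p; have /= Hv := Lv k kij p; have cp := c0 p.
    rewrite -/v in Hv.
    set ui := pd i u p in ti; set uj := pd j u p in tj.
    set vi := pd i v p in ti; set vj := pd j v p in tj.
    set uii := pd i (pd i u) p in Hu ti.
    set ujj := pd j (pd j u) p in Hu tj.
    set vii := pd i (pd i v) p in Hv ti.
    set vjj := pd j (pd j v) p in Hv tj.
    (* The condition along [j], multiplied by [c p], is added to the one along [i]: by the equations
       for [u] and [v] the second derivatives cancel and only squares remain. *)
    have S : vi ^+ 2 + c p * vj ^+ 2 + eps * (ui ^+ 2 + c p * uj ^+ 2) <= 0.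
      have tj' := mulr_ge0_le0 (ltW cp) tj.
      have : 2 * (vi ^+ 2 + c p * vj ^+ 2) + 2 * v p * (vii + c p * vjj)
         + 2 * eps * (ui ^+ 2 + c p * uj ^+ 2 + u p * (uii + c p * ujj)) <= 0.
        have := lerD ti tj'; rewrite addr0; apply: le_trans; rewrite le_eqVlt.
        by apply/orP; left; apply/eqP; ring.
      rewrite Hu Hv; lra.
    have cj : 0 <= c p * uj ^+ 2 by rewrite mulr_ge0 ?sqr_ge0 ?ltW.
    have cvj : 0 <= c p * vj ^+ 2 by rewrite mulr_ge0 ?sqr_ge0 ?ltW.
    have eS : eps * (ui ^+ 2 + c p * uj ^+ 2) <= 0.
      by have := sqr_ge0 vi; lra.
    rewrite pmulr_rle0// in eS.
    move: kij; rewrite !inE => /orP[] /eqP kk; rewrite /v kk.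
      rewrite -/ui; apply/eqP; rewrite -sqrf_eq0 eq_le sqr_ge0 andbT; lra.
    rewrite -/uj; apply/eqP; rewrite -sqrf_eq0 eq_le sqr_ge0 andbT.
    rewrite -(pmulr_rle0 _ cp); have := sqr_ge0 ui; lra.
  have := Hp x; rewrite /Phi !addrfctE !mulrfctE v0 mul0r add0r /cst.
  have := Hq p; rewrite !mulrfctE => Hqp Hpx.
  have : 0 <= eps * (u x * u x) by rewrite mulr_ge0 -?expr2 ?sqr_ge0 ?ltW.
  have : eps * (u p * u p) <= eps * (u q * u q) by rewrite ler_pM2l.
  rewrite expr2; lra.
by move=> x; split; apply: main; rewrite !inE eqxx ?orbT.
Qed.
End MaximumPrinciple.

(** * Liouville's theorem for periodic Cauchy-Riemann systems *)

Section Liouville.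
Variables (R : realType) (N : nat).
Local Notation vec := 'rV[R]_N.
Local Notation e := (evec R).
Implicit Types (f g u v p q : vec -> R) (i j k : 'I_N) (x y : vec).

(** [pd] is a total function, so a zero value does not imply derivability, and the coefficients
    concerned are not assumed smooth. *)
Definition D_vanishes k f := forall x, derivable f x (e k) /\ pd k f x = 0.

Lemma pd_affine k f g u p x : smooth u -> D_vanishes k g -> D_vanishes k p ->
  f = g * u + p -> pd k f x = g x * pd k u x.
Proof.
move=> su /(_ x)[dg Dg] /(_ x)[dp Dp] ->.
have du := smooth_derivable k x su.
by rewrite (pdD (derivableM dg du) dp) (pdM dg du) Dg Dp mulr0 !addr0.
Qed.

(* A doubly periodic holomorphic function is constant; the constant right-hand
   sides are then zero as well. *)
Lemma periodic_Liouville u v i j g p q : smooth u -> smooth v ->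
  periodic u -> periodic v -> (forall x, 0 < g x) ->
  (forall k, k \in [:: i; j] -> [/\ D_vanishes k g, D_vanishes k p & D_vanishes k q]) ->
  (forall x, pd i u x = g x * pd j v x + p x) ->
  (forall x, pd i v x = - (g x * pd j u x) + q x) ->
  forall x, [/\ pd i u x = 0, pd j u x = 0, pd i v x = 0 & pd j v x = 0].
Proof.
move=> su sv pu pv g0 H Eu Ev.
have [gi pi qi] : [/\ D_vanishes i g, D_vanishes i p & D_vanishes i q].
  by apply: H; rewrite inE eqxx.
have [gj pj qj] : [/\ D_vanishes j g, D_vanishes j p & D_vanishes j q].
  by apply: H; rewrite !inE eqxx orbT.
have Ng k : D_vanishes k g -> D_vanishes k (- g).
  move=> gk x; have [dg] := gk x; rewrite !pdE => Dg.
  by split; [exact: derivableN|rewrite deriveN// Dg oppr0].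
have Eu' : pd i u = g * pd j v + p by apply/funext => x; rewrite Eu.
have Ev' : pd i v = (- g) * pd j u + q.
  by apply/funext => x; rewrite Ev addrfctE mulrfctE opprfctE mulNr.
have suj := smooth_pd j su; have svj := smooth_pd j sv.
have uii x := pd_affine x svj gi pi Eu'.
have uij x := pd_affine x svj gj pj Eu'.
have vii x := pd_affine x suj (Ng _ gi) qi Ev'.
have vij x := pd_affine x suj (Ng _ gj) qj Ev'.
have c0 x : 0 < (g * g) x by rewrite mulr_gt0.
have Dc k : k \in [:: i; j] -> forall x, pd k (g * g) x = 0 /\ derivable (g * g) x (e k).
  move=> /H[gk _ _] x; have [dg Dg] := gk x; split; last exact: derivableM.
  by rewrite (pdM dg dg) Dg mulr0 addr0.
(* Elimination of the other unknown: mixed derivatives commute and [g] is constant along the plane,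
   so [u] and [v] both solve the elliptic equation with coefficient [g ^ 2]. *)
have Lu x : pd i (pd i u) x + (g * g) x * pd j (pd j u) x = 0.
  by rewrite uii (pd_comm i j sv) vij opprfctE mulrfctE; ring.
have Lv x : pd i (pd i v) x + (g * g) x * pd j (pd j v) x = 0.
  by rewrite vii (pd_comm i j su) uij opprfctE mulrfctE; ring.
move=> x; have [] := elliptic_vanish su pu c0 Dc Lu x.
by have [] := elliptic_vanish sv pv c0 Dc Lv x.
Qed.

End Liouville.

(** * The functions [exp (s cos (2 pi x_o))] *)

Section OneCoordinate.
Variables (R : realType) (N : nat) (o : 'I_N).
Local Notation vec := 'rV[R]_N.
Local Notation e := (evec R).

Lemma is_derive_coord (F : R -> R) (dF : R) i (x : vec) :
  is_derive (x 0 o) 1 F dF ->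
  is_derive x (e i) (fun y : vec => F (y 0 o)) ((i == o)%:R * dF).
Proof.
move=> [cF DF].
have [->|io] := eqVneq i o.
  have E : (fun h : R => h^-1 *: (((fun y : vec => F (y 0 o)) \o shift x) (h *: e o) - F (x 0 o)))
    = (fun h : R => h^-1 *: ((F \o shift (x 0 o)) (h *: 1) - F (x 0 o))).
    apply/funext => h /=; congr (_ *: (F _ - _)).
    by rewrite !mxE !eqxx.
  by split; rewrite ?mul1r /derivable /derive E.
have E : (fun y : vec => F (y 0 o)) \o shift x \o (fun h : R => h *: e i) = cst (F (x 0 o)).
  apply/funext => h /=; congr F.
  by rewrite !mxE eqxx eq_sym (negbTE io) mulr0 add0r.
have E2 : (fun h : R => h^-1 *: (((fun y : vec => F (y 0 o)) \o shift x) (h *: e i) - F (x 0 o)))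
    = cst 0.
  apply/funext => h /=; have /= := congr1 (@^~ h) E; rewrite /cst => ->.
  by rewrite subrr scaler0.
by split; rewrite ?mul0r /derivable /derive E2; [exact: is_cvg_cst|exact: lim_cst].
Qed.

Definition cosc (x : vec) : R := cos (2 * pi * x 0 o).
Definition sinc (x : vec) : R := sin (2 * pi * x 0 o).
Definition expc (s : R) (x : vec) : R := expR (s * cosc x).

Lemma is_derive_scale (t : R) (y : R) : is_derive y 1 (fun s => t * s) t.
Proof.
have := @is_deriveZ _ _ _ (@id R) t y 1 1 (is_derive_id _ _).
by rewrite /GRing.scale/= mulr1.
Qed.

Lemma is_derive_cosc i x : is_derive x (e i) cosc ((i == o)%:R * (- (2 * pi) * sinc x)).
Proof.
apply: (@is_derive_coord (fun s => cos (2 * pi * s))).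
have H := @is_derive1_comp R cos (fun s => 2 * pi * s) _ _ _ (is_derive_cos _) (is_derive_scale _ (x 0 o)).
by apply: (is_derive_eq H); rewrite /sinc; ring.
Qed.

Lemma is_derive_sinc i x : is_derive x (e i) sinc ((i == o)%:R * ((2 * pi) * cosc x)).
Proof.
apply: (@is_derive_coord (fun s => sin (2 * pi * s))).
have H := @is_derive1_comp R sin (fun s => 2 * pi * s) _ _ _ (is_derive_sin _) (is_derive_scale _ (x 0 o)).
by apply: (is_derive_eq H); rewrite /cosc; ring.
Qed.

Lemma is_derive_expc s i x :
  is_derive x (e i) (expc s) ((i == o)%:R * (- (2 * pi * s) * sinc x * expc s x)).
Proof.
apply: (@is_derive_coord (fun y => expR (s * cos (2 * pi * y)))).
have H1 := @is_derive1_comp R cos (fun s => 2 * pi * s) _ _ _ (is_derive_cos _) (is_derive_scale _ (x 0 o)).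
have H2 := @is_derive1_comp R _ _ _ _ _ (is_derive_scale s _) H1.
have H3 := @is_derive1_comp R expR _ _ _ _ (is_derive_expR _) H2.
apply: (is_derive_eq H3).
by rewrite /= /expc /cosc /sinc; ring.
Qed.

Lemma continuous_coord (F : R -> R) : continuous F -> continuous (fun x : vec => F (x 0 o)).
Proof.
move=> cF x; apply: (@continuous_comp _ _ _ (fun x : vec => x 0 o) F); last exact: cF.
exact: coord_continuous.
Qed.

Lemma continuous_cosc : continuous cosc.
Proof.
apply: (@continuous_coord (fun s => cos (2 * pi * s))) => y.
apply: (@continuous_comp _ _ _ (fun s => 2 * pi * s) cos); last exact: continuous_cos.
exact: mulrl_continuous.
Qed.

Lemma continuous_sinc : continuous sinc.
Proof.
apply: (@continuous_coord (fun s => sin (2 * pi * s))) => y.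
apply: (@continuous_comp _ _ _ (fun s => 2 * pi * s) sin); last exact: continuous_sin.
exact: mulrl_continuous.
Qed.

Lemma continuous_expc s : continuous (expc s).
Proof.
move=> x; apply: (@continuous_comp _ _ _ (fun x => s * cosc x) expR); last exact: continuous_expR.
apply: (@continuous_comp _ _ _ cosc (fun y => s * y)); first exact: continuous_cosc.
exact: mulrl_continuous.
Qed.

(** Up to constants each function is the derivative of the other, hence the simultaneous
    induction. *)
Lemma C_k_cosc_sinc k : C_k k cosc /\ C_k k sinc.
Proof.
elim: k => [|k [IHc IHs]]; first by split; [exact: continuous_cosc|exact: continuous_sinc].
split; split; do [exact: continuous_cosc|exact: continuous_sinc|move=> i; split].
- by move=> x; have [] := is_derive_cosc i x.
- have -> : (fun x => 'D_(e i) cosc x) = cst ((i == o)%:R * (- (2 * pi))) * sinc.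
    by apply/funext => x; have [_ ->] := is_derive_cosc i x; rewrite mulrfctE mulrA.
  by apply: C_kM => //; exact: C_k_cst.
- by move=> x; have [] := is_derive_sinc i x.
- have -> : (fun x => 'D_(e i) sinc x) = cst ((i == o)%:R * (2 * pi)) * cosc.
    by apply/funext => x; have [_ ->] := is_derive_sinc i x; rewrite mulrfctE mulrA.
  by apply: C_kM => //; exact: C_k_cst.
Qed.

Lemma smooth_expc s : smooth (expc s).
Proof.
elim=> [|k IH]; first exact: continuous_expc.
split=> [|i]; first exact: continuous_expc.
split=> [x|]; first by have [] := is_derive_expc s i x.
have -> : (fun x => 'D_(e i) (expc s) x) =
    cst ((i == o)%:R * (- (2 * pi * s))) * (sinc * expc s).
  by apply/funext => x; have [_ ->] := is_derive_expc s i x; rewrite !mulrfctE /cst; ring.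
apply: C_kM; first exact: C_k_cst.
by apply: C_kM => //; have [] := C_k_cosc_sinc k.
Qed.

Lemma periodic_expc s : periodic (expc s).
Proof.
move=> i x; rewrite /expc /cosc !mxE eqxx/=.
case: eqP => _; last by rewrite addr0.
by rewrite mulrDr mulr1 [2 * pi]mulr_natl cosD2pi.
Qed.

Lemma expc_gt0 s x : 0 < expc s x.
Proof. exact: expR_gt0. Qed.

Lemma expc0 x : expc 0 x = 1.
Proof. by rewrite /expc mul0r expR0. Qed.

Lemma expcN s x : expc (- s) x = (expc s x)^-1.
Proof. by rewrite /expc mulNr expRN. Qed.

End OneCoordinate.

(** * Integrals of continuous functions over the unit cube *)

Section UnitInterval.
Variable R : realType.
Local Notation mu := (@lebesgue_measure R).
Local Notation I01 := (`[0, 1]%classic : set R).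
Implicit Types G H : R -> R.

Lemma continuous_integrable01 G : continuous G -> mu.-integrable I01 (EFin \o G).
Proof.
move=> cG; apply: continuous_compact_integrable; first exact: segment_compact.
exact: continuous_subspaceT.
Qed.

Lemma measure01 : fine (mu I01) = 1.
Proof. by rewrite lebesgue_measure_itv/= lte01 -EFinD subr0. Qed.

(** A positive value [G t] keeps [G] above [G t / 2] on an interval of positive length, which makes
    the integral positive. *)
Lemma Rintegral01_eq0 G : continuous G -> (forall t, 0 <= t <= 1 -> 0 <= G t) ->
  Rintegral mu I01 G = 0 -> forall t, 0 <= t <= 1 -> G t = 0.
Proof.
move=> cG G0 IG t /andP[t0 t1]; apply/eqP; rewrite eq_le G0 ?t0 ?t1// andbT.
rewrite leNgt; apply/negP => Gt.
have /cvgrPdist_lt := cG t.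
have e0 : 0 < G t / 2 by lra.
move=> /(_ _ e0)[d /= d0 Hd].
(* Clipping keeps the interval inside [[0, 1]]; it stays nondegenerate even when [t] is an
   endpoint. *)
pose a := Num.max 0 (t - d / 2); pose b := Num.min 1 (t + d / 2).
have ab : a < b by rewrite /a /b lt_min !gt_max; apply/andP; split; apply/andP; split; lra.
have a0 : 0 <= a by rewrite /a le_max lexx.
have b1 : b <= 1 by rewrite /b ge_min lexx.
have Gab s : a <= s <= b -> G t / 2 <= G s.
  move=> /andP[]; rewrite /a /b ge_max le_min => /andP[s0 sa] /andP[s1 sb].
  have : `|t - s| < d by rewrite ltr_norml; apply/andP; split; lra.
  by move=> /Hd /=; rewrite ltr_norml => /andP[_]; lra.
have mab : measurable `[a, b]%classic by exact: measurable_itv.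
have m01 : measurable I01 by exact: measurable_itv.
have sub : `[a, b]%classic `<=` I01.
  move=> s /=; rewrite !in_itv/= => /andP[as_ sb]; apply/andP; split; lra.
have iG := continuous_integrable01 cG.
have iGab : mu.-integrable `[a, b]%classic (EFin \o G).
  apply: continuous_compact_integrable; first exact: segment_compact.
  exact: continuous_subspaceT.
have le1 : Rintegral mu `[a, b]%classic (fun=> G t / 2) <= Rintegral mu `[a, b]%classic G.
  apply: le_Rintegral => //.
    apply: continuous_compact_integrable; first exact: segment_compact.
    by apply: continuous_subspaceT => ?; exact: cvg_cst.
have le2 : Rintegral mu `[a, b]%classic G <= Rintegral mu I01 G.
  rewrite /Rintegral fine_le//.
  - exact: integrable_fin_num.
  - exact: integrable_fin_num.
  apply: ge0_subset_integral => //.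
    by case/integrableP : iG.
have mE : fine (mu `[a, b]%classic) = b - a.
  by rewrite lebesgue_measure_itv/= lte_fin ab -EFinD.
have := le_trans le1 le2; rewrite IG Rintegral_cst// mE.
by apply/negP; rewrite -ltNge mulr_gt0// subr_gt0.
Qed.

End UnitInterval.

Section CubeIntegral.
Variable R : realType.

Definition cons_row N (t : R) (y : 'rV[R]_N) : 'rV[R]_N.+1 :=
  row_mx (t%:M : 'rV[R]_1) y : 'rV[R]_(1 + N).

Lemma cons_row0 N t (y : 'rV[R]_N) : cons_row t y 0 ord0 = t.
Proof. by rewrite /cons_row mxE; case: splitP => j // _; rewrite ord1 mxE eqxx. Qed.

Lemma cons_rowS N t (y : 'rV[R]_N) j : cons_row t y 0 (lift ord0 j) = y 0 j.
Proof.
rewrite /cons_row mxE; case: splitP => k /=.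
  by move=> E; have := ltn_ord k; rewrite -E /bump/=; case: k {E}.
by rewrite /bump leq0n add1n => -[] E; congr (y 0 _); apply: val_inj.
Qed.

Lemma cons_row_eta N (x : 'rV[R]_N.+1) :
  x = cons_row (x 0 ord0) (\row_j x 0 (lift ord0 j)).
Proof.
apply/rowP => j; case: (unliftP ord0 j) => [k ->|->].
  by rewrite cons_rowS mxE.
by rewrite cons_row0.
Qed.

Lemma continuous_cons_row N :
  continuous (fun p : R * 'rV[R]_N => cons_row p.1 p.2).
Proof.
move=> [t y] A /= [P Pn PA].
have H (i : 'I_1) j : nbhs (t, y) (fun p : R * 'rV[R]_N => P i j (cons_row p.1 p.2 i j)).
  rewrite ord1; have := Pn 0 j; case: (unliftP ord0 j) => [k ->|->].
    rewrite cons_rowS => nP.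
    have c : {for (t, y), continuous (fun p : R * 'rV[R]_N => p.2 0 k)}.
      apply: (@continuous_comp _ _ _ snd (fun y : 'rV[R]_N => y 0 k)); first exact: cvg_snd.
      exact: coord_continuous.
    suff -> : (fun p : R * 'rV[R]_N => P 0 (lift ord0 k) (cons_row p.1 p.2 0 (lift ord0 k)))
      = (fun p => P 0 (lift ord0 k) (p.2 0 k)) by exact: c.
    by apply/funext => p; rewrite cons_rowS.
  rewrite cons_row0 => nP.
  have c : {for (t, y), continuous (fun p : R * 'rV[R]_N => p.1)} by exact: cvg_fst.
  suff -> : (fun p : R * 'rV[R]_N => P 0 ord0 (cons_row p.1 p.2 0 ord0))
    = (fun p => P 0 ord0 p.1) by exact: c.
  by apply/funext => p; rewrite cons_row0.
pose f (ij : 'I_1 * 'I_N.+1) : set (R * 'rV[R]_N) :=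
  fun p => P ij.1 ij.2 (cons_row p.1 p.2 ij.1 ij.2).
have FF : Filter (nbhs ((t, y) : R * 'rV[R]_N)) by exact: nbhs_filter.
have K := filter_forall FF (fun ij => H ij.1 ij.2 : nbhs _ (f ij)).
apply: (@filterS _ _ FF _ ((fun p : R * 'rV[R]_N => cons_row p.1 p.2) @^-1` A) _ K).
by move=> p Hp; apply: PA => i j; exact: (Hp (i, j)).
Qed.

Lemma unit_cube_cons N t (y : 'rV[R]_N) :
  0 <= t <= 1 -> unit_cube y -> unit_cube (cons_row t y).
Proof.
by move=> t01 Cy j; case: (unliftP ord0 j) => [k ->|->]; rewrite ?cons_rowS ?cons_row0.
Qed.

Lemma cube_integralS N (f : 'rV[R]_N.+1 -> R) : cube_integral f =
  Rintegral (@lebesgue_measure R) `[0, 1]%classic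
    (fun t => cube_integral (fun y => f (cons_row t y))).
Proof. by []. Qed.

(** Monotonicity and translation by constants go through one induction on the dimension: the
    inductive step needs the inner integral to be continuous, and this continuity is derived from
    the two properties in lower dimension. *)
Definition le_integral_spec N := forall f g : 'rV[R]_N -> R,
  continuous f -> continuous g -> (forall x, unit_cube x -> f x <= g x) ->
  cube_integral f <= cube_integral g.

Definition shift_integral_spec N := forall (f : 'rV[R]_N -> R) c,
  continuous f -> cube_integral (fun x => f x + c) = cube_integral f + c.

Lemma continuous_partial (N : nat) (F : R -> 'rV[R]_N -> R) :
  continuous (fun p => F p.1 p.2) -> forall t, continuous (F t).
Proof.
move=> cF t y.
apply: (@continuous_comp _ _ _ (fun y : 'rV[R]_N => (t, y)) (fun p => F p.1 p.2)).
  move=> A [[P Q] /= [nP nQ] PQ].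
  have FF : Filter (nbhs (y : 'rV[R]_N)) by exact: nbhs_filter.
  apply: (@filterS _ _ FF Q) nQ => z Qz.
  exact: (PQ (t, z) (conj (nbhs_singleton nP) Qz)).
exact: cF.
Qed.

Lemma continuous_addc (T : topologicalType) (f : T -> R) (c : R) :
  continuous f -> continuous (fun x => f x + c).
Proof. by move=> cf x; have := continuousD (cf x) (@cst_continuous _ _ c x); exact. Qed.

(** On the compact cube [F t] is uniformly close to [F t0] for [t] near [t0]; monotonicity and
    translation carry the bound over to the integrals. *)
Lemma continuous_cube_integral N (F : R -> 'rV[R]_N -> R) :
  le_integral_spec N -> shift_integral_spec N ->
  continuous (fun p => F p.1 p.2) -> continuous (fun t => cube_integral (F t)).
Proof.
move=> leI shI cF t0; apply/cvgrPdist_le => /= eps eps0.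
have cFt := continuous_partial cF.
have FF : Filter (nbhs (t0 : R)) by exact: nbhs_filter.
have : \forall t \near (t0 : R), @unit_cube R N `<=` (fun y => `|F t0 y - F t y| <= eps).
  have NC := (compact_near_coveringP _).1 (@unit_cube_compact R N) R (nbhs t0)
    (fun t y => `|F t0 y - F t y| <= eps) FF.
  apply: NC => y _.
  have e2 : 0 < eps / 2 by lra.
  have /cvgrPdist_lt/(_ _ e2) := cF (t0, y).
  move=> [[A B] /= [nA nB] AB]; exists (B, A) => //= -[y' t] /= [By' At].
  have h1 := AB (t0, y') (conj (nbhs_singleton nA) By').
  have h2 := AB (t, y') (conj At By'); rewrite /= in h1 h2.
  move: h1 h2; rewrite !ltr_norml ler_norml => /andP[a1 a2] /andP[b1 b2].
  by apply/andP; split; lra.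
apply: filterS => t Ht; rewrite ler_norml; apply/andP; split.
  rewrite lerBrDl -lerBrDr opprK -shI//; apply: leI => //.
    exact: continuous_addc.
  by move=> x /Ht; rewrite ler_norml => /andP[]; lra.
rewrite lerBlDr [eps + _]addrC -shI//; apply: leI => //.
  exact: continuous_addc.
by move=> x /Ht; rewrite ler_norml => /andP[]; lra.
Qed.

Lemma continuous_slices N (f : 'rV[R]_N.+1 -> R) : continuous f ->
  continuous (fun p : R * 'rV[R]_N => f (cons_row p.1 p.2)).
Proof.
move=> cf p; apply: (@continuous_comp _ _ _ (fun p : R * 'rV[R]_N => cons_row p.1 p.2) f).
  exact: continuous_cons_row.
exact: cf.
Qed.

Lemma continuous_slice N (f : 'rV[R]_N.+1 -> R) (t : R) : continuous f ->
  continuous (fun y : 'rV[R]_N => f (cons_row t y)).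
Proof.
move=> cf.
exact: (@continuous_partial N (fun t y => f (cons_row t y)) (continuous_slices cf)).
Qed.

Lemma cube_integral_le_shift N : le_integral_spec N /\ shift_integral_spec N.
Proof.
elim: N => [|N [leI shI]].
  split; first by move=> f g _ _; apply => -[].
  by [].
have m01 : measurable (`[0, 1]%classic : set R) by exact: measurable_itv.
have cI (f : 'rV[R]_N.+1 -> R) : continuous f ->
    continuous (fun t => cube_integral (fun y => f (cons_row t y))).
  move=> cf; apply: (@continuous_cube_integral N (fun t y => f (cons_row t y)) leI shI).
  exact: continuous_slices.
split.
  move=> f g cf cg fg; rewrite !cube_integralS; apply: le_Rintegral => //.
  - by apply: continuous_integrable01; exact: cI.
  - by apply: continuous_integrable01; exact: cI.
  move=> t /=; rewrite in_itv/= => t01; apply: leI.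
  - exact: continuous_slice.
  - exact: continuous_slice.
  by move=> y Cy; apply: fg; exact: unit_cube_cons.
move=> f c cf; rewrite !cube_integralS.
under eq_Rintegral => t _.
  rewrite shI; last exact: continuous_slice.
  over.
rewrite RintegralD//; [|exact/continuous_integrable01/cI|].
  by rewrite Rintegral_cst// measure01 mulr1.
by apply: continuous_integrable01 => x; exact: cvg_cst.
Qed.

Lemma cube_integral_ge0 N (f : 'rV[R]_N -> R) :
  (forall x, 0 <= f x) -> 0 <= cube_integral f.
Proof.
elim: N f => [|N IH] f f0; first exact: f0.
by rewrite cube_integralS; apply: Rintegral_ge0 => t _; exact: IH.
Qed.

Lemma cube_integralN N (f : 'rV[R]_N -> R) : continuous f ->
  cube_integral (fun x => - f x) = - cube_integral f.
Proof.
elim: N f => [|N IH] f cf //; rewrite !cube_integralS.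
under eq_Rintegral => t _.
  rewrite IH; last exact: continuous_slice.
  rewrite -mulN1r.
  over.
rewrite RintegralZl ?mulN1r//.
apply: continuous_integrable01.
have [leI shI] := cube_integral_le_shift N.
apply: (@continuous_cube_integral N (fun t y => f (cons_row t y)) leI shI).
exact: continuous_slices.
Qed.

(** The integrals over the slices form a nonnegative continuous function of the first coordinate, so
    each of them vanishes and the induction hypothesis applies to the slice. *)
Lemma cube_integral_eq0 N (f : 'rV[R]_N -> R) : continuous f ->
  (forall x, 0 <= f x) -> cube_integral f = 0 ->
  forall x, unit_cube x -> f x = 0.
Proof.
elim: N f => [|N IH] f cf f0 If x Cx; first by rewrite -If /=; congr f; apply/rowP => -[].
have [leI shI] := cube_integral_le_shift N.
have t01 := Cx ord0.
have cI := @continuous_cube_integral N (fun t y => f (cons_row t y)) leI shI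
  (continuous_slices cf).
have /= It := Rintegral01_eq0 cI
  (fun t _ => cube_integral_ge0 (fun y => f0 (cons_row t y))) If t01.
rewrite (cons_row_eta x); apply: (IH (fun y => f (cons_row (x 0 ord0) y))) => //.
  exact: continuous_slice.
by move=> j; rewrite mxE.
Qed.

End CubeIntegral.

(** * The exterior algebra *)

Section Exterior.
Variables (R : realType) (N : nat).
Local Notation C := (R[i])%C.
Local Notation ext := (ext R N).
Implicit Types (a b : ext) (I K S : {set 'I_N}) (i j k : 'I_N).
Implicit Types w : 'I_N -> 'I_N -> R[i]%C.

Lemma sum_card1 (V : zmodType) (F : {set 'I_N} -> V) :
  (forall I, #|I| != 1%N -> F I = 0) -> \sum_I F I = \sum_i F [set i]%SET.
Proof.
move=> F0; transitivity (\sum_i \sum_(I | I == [set i]%SET) F I); last first.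
  by apply: eq_bigr => i _; rewrite big_pred1_eq.
rewrite (exchange_big_dep xpredT)//=; apply: eq_bigr => I _.
have [/cards1P[k ->]|I1] := boolP (#|I| == 1%N); last first.
  by rewrite F0// big1.
rewrite (eq_bigl (pred1 k)) ?big_pred1_eq// => i /=.
by rewrite eq_sym (inj_eq finset.set1_inj).
Qed.

Lemma covector1 (w : 'I_N -> R[i]%C) j : covector w [set j]%SET = w j.
Proof.
rewrite ffunE (eq_bigl (pred1 j)) ?big_pred1_eq// => i /=.
by rewrite (inj_eq finset.set1_inj) eq_sym.
Qed.

Lemma wedge_covector (w : 'I_N -> R[i]%C) b K : wedge (covector w) b K =
  \sum_(i in K) (-1) ^+ #|[set j in K | (j < i)%N]%SET| * (w i * b (K :\ i)%SET).
Proof.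
rewrite ffunE big_mkcond/= sum_card1; last first.
  move=> I I1; case: ifP => // _; rewrite ffunE big_pred0 ?mulr0 ?mul0r// => j.
  by apply: contraNF I1 => /eqP ->; rewrite cards1.
rewrite [RHS]big_mkcond/=; apply: eq_bigr => i _; rewrite finset.sub1set.
case: ifP => // iK; rewrite covector1 mulrA; congr (_ * _ * _).
rewrite /wedge_sign; congr (_ ^+ _).
(* The inversions counted by the sign are the pairs [(i, j)] with [j] in [K] below [i]. *)
rewrite -(@card_imset _ _ (fun j => (i, j))); last by move=> ? ? [].
apply: eq_card => -[k l]; rewrite !inE/=; apply/idP/imsetP.
  move=> /andP[/andP[/eqP -> /andP[_ lK]] li].
  by exists l; rewrite // inE lK.
move=> [j]; rewrite inE => /andP[jK ji] [-> ->].
by rewrite eqxx jK ji andbT/= neq_ltn ji.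
Qed.

Definition wedge_list w (s : seq 'I_N) : ext :=
  foldr (fun i a => wedge (covector (w i)) a) (ext_one R N) s.

Lemma wedge_list_degree w s K : #|K| != size s -> wedge_list w s K = 0.
Proof.
elim: s K => [|i s IH] K /=.
  by rewrite cards_eq0 ffunE => /negbTE ->.
move=> Ks; rewrite wedge_covector big1// => k kK.
rewrite IH ?mulr0//; apply: contraNneq Ks => <-.
by rewrite (finset.cardsD1 k K) kK.
Qed.

Lemma wedge_over_degree w I K : #|K| != #|I| -> wedge_over w I K = 0.
Proof. by move=> KI; apply: wedge_list_degree; rewrite -cardE. Qed.

Lemma enum_set_sorted I : sorted (fun i j : 'I_N => (i < j)%N) (enum I).
Proof.
rewrite {1}/enum_mem sorted_filter//; first by move=> ? ? ?; exact: ltn_trans.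
rewrite -(@sorted_map _ _ (@nat_of_ord N) ltn) -enumT val_enum_ord.
exact: iota_ltn_sorted.
Qed.

Lemma wedge_list_diag w (d : 'I_N -> R[i]%C) s K :
  (forall i j, w i j = (i == j)%:R * d i) ->
  sorted (fun i j : 'I_N => (i < j)%N) s ->
  wedge_list w s K = (K == [set j in s]%SET)%:R * \prod_(i <- s) d i.
Proof.
move=> wd; elim: s K => [|i s IH] K /=.
  rewrite ffunE big_nil mulr1 (_ : [set j in [::]]%SET = finset.set0)//.
rewrite path_sortedE; last by move=> ? ? ?; exact: ltn_trans.
move=> /andP[/allP is_ ss]; rewrite wedge_covector big_cons.
have is' : i \notin s by apply/negP => /is_; rewrite ltnn.
under [LHS]eq_bigr => k _ do rewrite wd (IH _ ss).
have [iK|iK] := boolP (i \in K); last first.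
  rewrite big1 => [|k kK]; last first.
    by rewrite (_ : i == k = false) ?mul0r ?mulr0//; apply: contraNF iK => /eqP ->.
  rewrite (_ : K == _ = false) ?mul0r//; apply: contraNF iK => /eqP ->.
  by rewrite inE mem_head.
rewrite (bigD1 i)//= [X in _ + X]big1 ?addr0 => [|k /andP[_ ki]]; last first.
  by rewrite eq_sym (negbTE ki) !mul0r mulr0.
rewrite eqxx mul1r.
have -> : (K == [set j in i :: s]%SET) = (K :\ i == [set j in s])%SET.
  apply/eqP/eqP => [->|E].
    apply/finset.setP => j; rewrite !inE; case: eqP => //= ->.
    by rewrite (negbTE is').
  rewrite -(finset.setD1K iK) E; apply/finset.setP => j; by rewrite !inE.
case: eqP => [E|_]; last by rewrite !mul0r !mulr0.
rewrite (_ : [set j in K | _]%SET = finset.set0) ?cards0 ?expr0 ?mul1r//.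
apply/finset.setP => j; rewrite !inE; apply/negP => /andP[jK ji].
have := finset.in_setD1 j K i; rewrite E jK andbT inE.
rewrite neq_ltn ji /= => /is_; by rewrite ltnNge (ltnW ji).
Qed.

(** With the standard covectors this yields the basis [dx^I]; with a diagonal inverse metric it
    makes the [dx^I] orthogonal. *)
Lemma wedge_over_diag w (d : 'I_N -> R[i]%C) I K :
  (forall i j, w i j = (i == j)%:R * d i) ->
  wedge_over w I K = (I == K)%:R * \prod_(i in I) d i.
Proof.
move=> wd; rewrite -big_enum/= eq_sym -[wedge_over w I]/(wedge_list w (enum I)).
rewrite (wedge_list_diag _ wd (enum_set_sorted I)).
rewrite (_ : [set j in enum I]%SET = I)//.
by apply/finset.setP => j; rewrite inE mem_enum.
Qed.

Lemma wedge_over1 w i j : wedge_over w [set i]%SET [set j]%SET = w i j.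
Proof.
rewrite /wedge_over enum_set1/= wedge_covector big_set1.
rewrite (_ : [set k in _ | _]%SET = finset.set0) ?cards0 ?expr0 ?mul1r.
  by rewrite finset.setDv ffunE eqxx mulr1.
by apply/finset.setP => k; rewrite !inE; case: eqP => // ->; rewrite ltnn.
Qed.

(* The antisymmetric matrix of the degree 2 part of [a]. *)
Definition altco a i j : R[i]%C :=
  ((i < j)%N%:R - (j < i)%N%:R) * a [set i; j]%SET.

(** The hypothesis is the common shape of an exterior derivative and of a wedge product with a
    covector, so that both are treated at once. *)
Lemma altco_sum a (F : 'I_N -> {set 'I_N} -> R[i]%C) i j :
  (forall K, a K = \sum_(k in K) (-1) ^+ #|[set l in K | (l < k)%N]%SET| * F k (K :\ k)%SET) ->
  altco a i j = F i [set j]%SET - F j [set i]%SET.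
Proof.
move=> aE; have lt2 (k l : 'I_N) : (k < l)%N ->
    a [set k; l]%SET = F k [set l]%SET - F l [set k]%SET.
  move=> kl; have knl : k != l by rewrite neq_ltn kl.
  rewrite aE finset.big_setU1 ?inE//= big_set1.
  have -> : [set m in [set k; l] | (m < k)%N]%SET = finset.set0.
    apply/finset.setP => m; rewrite !inE.
    by case: eqP => [->|_]; rewrite ?ltnn//; case: eqP => //= ->; rewrite ltnNge (ltnW kl).
  have -> : [set m in [set k; l] | (m < l)%N]%SET = [set k]%SET.
    apply/finset.setP => m; rewrite !inE.
    by case: eqP => [->|_]; rewrite ?kl//; case: eqP => //= ->; rewrite ltnn.
  rewrite cards0 cards1 expr0 expr1 mul1r mulN1r.
  congr (F k _ - F l _); apply/finset.setP => m; rewrite !inE.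
    by case: eqP => // ->; rewrite (negbTE knl).
  by case: eqP => [->|]; rewrite ?andbT ?andbF ?orbF// eq_sym (negbTE knl).
rewrite /altco; have [ij|ji|/val_inj ->] := ltngtP i j.
- by rewrite lt2// subr0 mul1r.
- by rewrite finset.setUC lt2// sub0r mulN1r opprB.
- by rewrite subrr mul0r subrr.
Qed.

Lemma enum_set2 i j : (i < j)%N -> enum [set i; j]%SET = [:: i; j].
Proof.
move=> ij; apply: (@irr_sorted_eq _ (fun i j : 'I_N => (i < j)%N)).
- by move=> ? ? ?; exact: ltn_trans.
- by move=> ?; rewrite /= ltnn.
- exact: enum_set_sorted.
- by rewrite /= ij.
- by move=> k; rewrite mem_enum !inE.
Qed.

Lemma altco_wedge_over w i j k l : (i < j)%N ->
  altco (wedge_over w [set i; j]%SET) k l = w i k * w j l - w i l * w j k.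
Proof.
move=> ij; rewrite (altco_sum (F := fun k K => w i k * wedge_over w [set j]%SET K)).
  by rewrite !wedge_over1.
by move=> K; rewrite /wedge_over enum_set2// enum_set1/= wedge_covector.
Qed.

(** The value of the degree 2 part of [a] on the vectors [u] and [v], normalised so that a wedge of
    two covectors gives a two by two determinant. *)
Definition ev a (u v : 'I_N -> R[i]%C) : R[i]%C :=
  \sum_i \sum_j altco a i j * (u i * v j).

Definition dual w i (u : 'I_N -> R[i]%C) : R[i]%C := \sum_j w i j * u j.

Lemma dual_id i u : dual (fun i j => (i == j)%:R) i u = u i.
Proof.
rewrite /dual (bigD1 i)//= big1 => [|k ki]; first by rewrite eqxx mul1r addr0.
by rewrite eq_sym (negbTE ki) mul0r.
Qed.

Lemma ev_sum (T : finType) (c : T -> R[i]%C) (a : T -> ext) (P : pred T) u v :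
  ev (\sum_(t | P t) c t *: a t) u v = \sum_(t | P t) c t * ev (a t) u v.
Proof.
rewrite /ev; under [RHS]eq_bigr => t _ do rewrite mulr_sumr.
rewrite [RHS]exchange_big/=; apply: eq_bigr => i _.
under [RHS]eq_bigr => t _ do rewrite mulr_sumr.
rewrite [RHS]exchange_big/=; apply: eq_bigr => j _.
rewrite /altco sum_ffunE mulr_sumr mulr_suml; apply: eq_bigr => t _.
by rewrite ffunE /GRing.scale/=; ring.
Qed.

Lemma ev_wedge_over w i j u v : (i < j)%N ->
  ev (wedge_over w [set i; j]%SET) u v =
  dual w i u * dual w j v - dual w i v * dual w j u.
Proof.
move=> ij; rewrite /dual !big_distrlr/= [X in _ - X]exchange_big -sumrB/=.
apply: eq_bigr => k _; rewrite -sumrB; apply: eq_bigr => l _.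
by rewrite altco_wedge_over//; ring.
Qed.

Lemma ev_degree a u v : (forall K, #|K| = 2 -> a K = 0) -> ev a u v = 0.
Proof.
move=> a0; rewrite /ev big1// => i _; rewrite big1// => j _; rewrite /altco.
have [ij|ji|/val_inj ->] := ltngtP i j; last by rewrite subrr !mul0r.
  by rewrite a0 ?mulr0 ?mul0r// cards2 neq_ltn ij.
by rewrite a0 ?mulr0 ?mul0r// cards2 neq_ltn ji orbT.
Qed.

Lemma ext_sum_basis a : a = \sum_I a I *: wedge_over (fun i j => (i == j)%:R) I.
Proof.
apply/ffunP => K; rewrite sum_ffunE (bigD1 K)//= big1 => [|I IK]; rewrite ffunE.
  rewrite (wedge_over_diag (d := fun=> 1)) => [|i j]; last by rewrite mulr1.
  by rewrite eqxx big1// mulr1 /GRing.scale/= mulr1 addr0.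
rewrite (wedge_over_diag (d := fun=> 1)) => [|i j]; last by rewrite mulr1.
by rewrite (negbTE IK) mul0r scaler0.
Qed.

Variable J : 'M[R]_N.

Lemma type_proj_degree p q a K : #|K|%:Z != p + q -> type_proj J p q a K = 0.
Proof.
move=> Kpq; rewrite sum_ffunE big1// => I _; rewrite ffunE sum_ffunE.
rewrite big1 ?scaler0// => S /and3P[SI /eqP Sp /eqP Iq].
rewrite wedge_over_degree//; apply: contraNneq Kpq => ->.
by rewrite -Sp -Iq -PoszD -(finset.cardsID S I) (finset.setIidPr SI).
Qed.

Lemma type_proj_degree_src p q a (m : nat) : (forall K, #|K| != m -> a K = 0) ->
  p + q != m%:Z -> type_proj J p q a = 0.
Proof.
move=> am pqm; rewrite /type_proj big1// => I _.
have [Im|/am ->] := boolP (#|I| == m); last by rewrite scale0r.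
rewrite big1 ?scaler0// => S /and3P[SI /eqP Sp /eqP Iq].
move: pqm; rewrite -Sp -Iq -PoszD -(eqP Im) -(finset.cardsID S I).
by rewrite (finset.setIidPr SI) eqxx.
Qed.

Lemma type_proj_neg p q a : (p < 0) || (q < 0) -> type_proj J p q a = 0.
Proof.
move=> pq; rewrite /type_proj big1// => I _; rewrite big_pred0 ?scaler0// => S.
apply/negP => /and3P[_ /eqP Sp /eqP Iq]; move: pq.
by rewrite -Sp -Iq.
Qed.

Lemma type_proj10 a j :
  type_proj J 1 0 a [set j]%SET = \sum_i a [set i]%SET * dx10 J i j.
Proof.
rewrite sum_ffunE sum_card1 => [|I I1]; last first.
  rewrite ffunE sum_ffunE big1 ?scaler0// => S _.
  by rewrite wedge_over_degree// cards1 eq_sym.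
apply: eq_bigr => i _; rewrite ffunE sum_ffunE (big_pred1 [set i]%SET) => [|S].
  by rewrite wedge_over1 inE eqxx.
rewrite finset.subset1; apply/and3P/eqP => [|->].
  by case=> /orP[/eqP ->//|/eqP ->]; rewrite cards0.
by rewrite eqxx cards1 finset.setDv cards0.
Qed.

Lemma type_proj01 a j :
  type_proj J 0 1 a [set j]%SET = \sum_i a [set i]%SET * dx01 J i j.
Proof.
rewrite sum_ffunE sum_card1 => [|I I1]; last first.
  rewrite ffunE sum_ffunE big1 ?scaler0// => S _.
  by rewrite wedge_over_degree// cards1 eq_sym.
apply: eq_bigr => i _; rewrite ffunE sum_ffunE (big_pred1 finset.set0) => [|S].
  by rewrite wedge_over1 inE.
rewrite finset.subset1; apply/and3P/eqP => [|->].
  by case=> /orP[/eqP ->|/eqP ->//]; rewrite cards1.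
by rewrite eqxx orbT cards0 finset.setD0 cards1.
Qed.

(* [u] and [v] are vectors of type (1, 0) and (0, 1). *)
Lemma ev_type_proj11 a (u v : 'I_N -> R[i]%C) :
  (forall i, dual (dx10 J) i u = u i) -> (forall i, dual (dx01 J) i u = 0) ->
  (forall i, dual (dx10 J) i v = 0) -> (forall i, dual (dx01 J) i v = v i) ->
  ev (type_proj J 1 1 a) u v = ev a u v.
Proof.
move=> u10 u01 v10 v01; rewrite [in RHS](ext_sum_basis a) !ev_sum.
apply: eq_bigr => I _; congr (_ * _).
have [I2|I2] := eqVneq #|I| 2; last first.
  rewrite !ev_degree// => K K2; first by rewrite wedge_over_degree// K2 eq_sym.
  rewrite sum_ffunE big1// => S _; by rewrite wedge_over_degree// K2 eq_sym.
have {I2}[i [j [ij ->]]] : exists i j, (i < j)%N /\ I = [set i; j]%SET.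
  have /cards2P[i [j [+ ->]]] := introT eqP I2; rewrite neq_ltn => /orP[ij|ji].
    by exists i, j.
  by exists j, i; rewrite finset.setUC.
(* Only two choices of [S] count, according to which of the two factors has type (1,0); each retains
   one of the two terms of the determinant. *)
have E : forall T, \sum_(S : {set 'I_N} | [&& S \subset [set i; j]%SET, #|S|%:Z == 1
     & #|([set i; j] :\: S)%SET|%:Z == 1]) T S = T [set i]%SET + T [set j]%SET :> ext.
  move=> T; rewrite big_mkcond/= sum_card1 => [|S S1]; last first.
    by case: ifP => // /and3P[_ /eqP[S1']]; rewrite S1' in S1.
  have inj : i != j by rewrite neq_ltn ij.
  have -> : T [set i]%SET + T [set j]%SET = \sum_(k in [set i; j]%SET) T [set k]%SET.
    by rewrite finset.big_setU1 ?inE//= big_set1.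
  rewrite [RHS]big_mkcond/=; apply: eq_bigr => k _.
  rewrite finset.sub1set cards1 eqxx/=; case: ifP => [/andP[-> //]|].
  case: (boolP (k \in _)) => //= kij.
  have := finset.cardsD1 k [set i; j]%SET.
  by rewrite kij cards2 inj add1n => -[<-].
rewrite E.
have evD b c : ev (b + c) u v = ev b u v + ev c u v.
  rewrite /ev -big_split; apply: eq_bigr => k _; rewrite -big_split.
  by apply: eq_bigr => l _; rewrite /altco ffunE/=; ring.
have D S k x : dual (fun k => if k \in S then dx10 J k else dx01 J k) k x =
    if k \in S then dual (dx10 J) k x else dual (dx01 J) k x.
  by rewrite /dual; case: ifP.
have ji : (j == i) = false by apply/negbTE; rewrite neq_ltn ij orbT.
rewrite evD !ev_wedge_over// !D !inE !eqxx ji [i == j]eq_sym ji.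
by rewrite !u10 !u01 !v10 !v01 !dual_id; ring.
Qed.

End Exterior.

(** * The L2 inner product for a diagonal metric *)

Section ComplexContinuity.
Variables (R : realType) (N : nat).
Local Notation vec := 'rV[R]_N.
Local Notation C := (R[i])%C.
Implicit Types (f g : vec -> C).

Definition contC f : Prop :=
  continuous (fun x => complex.Re (f x)) /\ continuous (fun x => complex.Im (f x)).

Lemma contC_cst (c : C) : contC (fun=> c).
Proof. by split=> x; exact: cst_continuous. Qed.

Lemma continuous_mul (u v : vec -> R) : continuous u -> continuous v ->
  continuous (fun x => u x * v x).
Proof. by move=> cu cv x; have := continuousM (cu x) (cv x); exact. Qed.

Lemma continuous_add (u v : vec -> R) : continuous u -> continuous v ->
  continuous (fun x => u x + v x).
Proof. by move=> cu cv x; have := continuousD (cu x) (cv x); exact. Qed.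

Lemma continuous_opp (u : vec -> R) : continuous u -> continuous (fun x => - u x).
Proof. by move=> cu x; have := continuousN (cu x); exact. Qed.

Lemma continuous_bigsum (T : Type) (r : seq T) (P : pred T) (u : T -> vec -> R) :
  (forall t, continuous (u t)) -> continuous (fun x => \sum_(t <- r | P t) u t x).
Proof.
move=> cu; have -> : (fun x => \sum_(t <- r | P t) u t x) = \sum_(t <- r | P t) u t.
  by apply/funext => x; rewrite fct_sumE.
elim/big_rec: _ => [|t v _ cv]; first by move=> x; exact: cst_continuous.
exact: continuous_add.
Qed.

Lemma contC_add f g : contC f -> contC g -> contC (fun x => f x + g x).
Proof.
move=> [fr fi] [gr gi]; split.
  have -> : (fun x => complex.Re (f x + g x)) = fun x => complex.Re (f x) + complex.Re (g x).
    by apply/funext => x; case: (f x) (g x) => [? ?] [].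
  exact: continuous_add.
have -> : (fun x => complex.Im (f x + g x)) = fun x => complex.Im (f x) + complex.Im (g x).
  by apply/funext => x; case: (f x) (g x) => [? ?] [].
exact: continuous_add.
Qed.

Lemma contC_mul f g : contC f -> contC g -> contC (fun x => f x * g x).
Proof.
move=> [fr fi] [gr gi]; split.
  have -> : (fun x => complex.Re (f x * g x)) = fun x =>
      complex.Re (f x) * complex.Re (g x) + - (complex.Im (f x) * complex.Im (g x)).
    by apply/funext => x; case: (f x) (g x) => [? ?] [].
  by apply: continuous_add; [|apply: continuous_opp]; exact: continuous_mul.
have -> : (fun x => complex.Im (f x * g x)) = fun x =>
    complex.Re (f x) * complex.Im (g x) + complex.Im (f x) * complex.Re (g x).
  by apply/funext => x; case: (f x) (g x) => [? ?] [].
by apply: continuous_add; exact: continuous_mul.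
Qed.

Lemma contC_sum (T : Type) (r : seq T) (P : pred T) (f : T -> vec -> C) :
  (forall t, contC (f t)) -> contC (fun x => \sum_(t <- r | P t) f t x).
Proof.
move=> cf; have -> : (fun x => \sum_(t <- r | P t) f t x) = \sum_(t <- r | P t) f t.
  by apply/funext => x; rewrite fct_sumE.
elim/big_rec: _ => [|t v _ cv]; first exact: contC_cst.
exact: contC_add.
Qed.

Lemma contC_real (u : vec -> R) : continuous u -> contC (fun x => (u x)%:C%C).
Proof. by move=> cu; split => //= x; exact: cst_continuous. Qed.

Lemma contC_smooth f : smoothC f -> contC f.
Proof. by move=> [sr si]; split; exact: smooth_continuous. Qed.

Lemma contC_partial i f : smoothC f -> contC (partialC i f).
Proof.
by move=> [sr si]; split; apply: smooth_continuous; exact: smooth_D.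
Qed.

Lemma contC_wedge_list (w : vec -> 'I_N -> 'I_N -> C) s K :
  (forall i j, contC (fun x => w x i j)) -> contC (fun x => wedge_list (w x) s K).
Proof.
move=> cw; elim: s K => [|i s IH] K /=; first exact: contC_cst.
under eq_fun do rewrite wedge_covector.
apply: contC_sum => j; apply: contC_mul; first exact: contC_cst.
by apply: contC_mul.
Qed.

Variable J : vec -> 'M[R]_N.
Hypothesis J_continuous : forall i j, continuous (fun x => J x i j).

Lemma contC_dx10 i j : contC (fun x => dx10 (J x) i j).
Proof.
apply: contC_mul; last exact: contC_cst.
have -> : (fun x => (i == j)%:R - 'i%C * (J x i j)%:C%C) =
    (fun x => (i == j)%:R + (- 'i%C) * (J x i j)%:C%C).
  by apply/funext => x; rewrite mulNr.
apply: contC_add; first exact: contC_cst.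
apply: contC_mul; first exact: contC_cst.
exact: contC_real.
Qed.

Lemma contC_dx01 i j : contC (fun x => dx01 (J x) i j).
Proof.
apply: contC_mul; last exact: contC_cst.
apply: contC_add; first exact: contC_cst.
apply: contC_mul; first exact: contC_cst.
exact: contC_real.
Qed.

Lemma contC_type_proj p q (a : form R N) K : (forall I, contC (fun x => a x I)) ->
  contC (fun x => type_proj (J x) p q (a x) K).
Proof.
move=> ca; under eq_fun do rewrite sum_ffunE.
apply: contC_sum => I; under eq_fun do rewrite ffunE.
apply: contC_mul => //; under eq_fun do rewrite sum_ffunE.
apply: contC_sum => S.
apply: (@contC_wedge_list (fun x i => if i \in S then dx10 (J x) i else dx01 (J x) i)).
by move=> i j; case: (i \in S); [exact: contC_dx10|exact: contC_dx01].
Qed.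

Lemma contC_ext_d (a : form R N) K : smooth_form a -> contC (fun x => ext_d a x K).
Proof.
move=> [_ sa]; under eq_fun do rewrite ffunE.
apply: contC_sum => i; apply: contC_mul; first exact: contC_cst.
exact: contC_partial.
Qed.

End ComplexContinuity.

(** * Positivity of the L2 product and its consequence for Laplacians *)

Section DiagonalMetric.
Variables (R : realType) (N : nat) (J : 'rV[R]_N -> 'M[R]_N).
Variable d : 'I_N -> 'rV[R]_N -> R.
Hypothesis d_gt0 : forall i x, 0 < d i x.
Hypothesis d_continuous : forall i, continuous (d i).
Hypothesis metricE : forall x, metric (J x) = diag_mx (\row_i d i x).
Hypothesis det_metric : forall x, \det (metric (J x)) = 1.
Local Notation C := (R[i])%C.

(** The squared norm of [dx^I] at [x], a minor of the diagonal inverse metric. *)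
Definition weight x (I : {set 'I_N}) : R := \prod_(i in I) (d i x)^-1.

Lemma weight_gt0 x I : 0 < weight x I.
Proof. by apply: prodr_gt0 => i _; rewrite invr_gt0. Qed.

Lemma weight_continuous I : continuous (weight ^~ I).
Proof.
have -> : weight ^~ I = \prod_(i in I) (fun x => (d i x)^-1).
  by apply/funext => x; rewrite fct_prodE.
elim/big_rec: _ => [|i v _ cv]; first by move=> x; exact: cst_continuous.
apply: continuous_mul => // x; apply: continuousV; first by rewrite gt_eqF.
exact: d_continuous.
Qed.

Lemma inv_metric x : invmx (metric (J x)) = diag_mx (\row_i (d i x)^-1).
Proof.
have E : metric (J x) *m diag_mx (\row_i (d i x)^-1) = 1%:M.
  rewrite metricE mulmx_diag; apply/matrixP => i j; rewrite !mxE.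
  by case: eqP => // ->; rewrite mulfV ?gt_eqF.
by have [u _] := mulmx1_unit E; rewrite -[LHS]mulmx1 -E mulmxA mulVmx// mul1mx.
Qed.

Lemma ext_innerE x (a b : ext R N) : ext_inner (J x) a b =
  \sum_I a I * conjc (b I : C) * (weight x I)%:C%C.
Proof.
apply: eq_bigr => I _; rewrite (bigD1 I)//= big1 ?addr0 => [|K KI]; last first.
  rewrite (wedge_over_diag (d := fun i => ((d i x)^-1)%:C%C)) => [|i j].
    by rewrite eq_sym (negbTE KI) mul0r mulr0.
  rewrite inv_metric !mxE; case: eqP => [->|]; rewrite ?mul1r ?mul0r//.
rewrite (wedge_over_diag (d := fun i => ((d i x)^-1)%:C%C)) => [|i j].
  by rewrite eqxx mul1r /weight rmorph_prod.
by rewrite inv_metric !mxE; case: eqP => [->|]; rewrite ?mul1r ?mul0r.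
Qed.

Definition re_inner x (a b : ext R N) : R :=
  \sum_I (complex.Re (a I) * complex.Re (b I) + complex.Im (a I) * complex.Im (b I))
    * weight x I.

Lemma Re_sum (T : finType) (f : T -> C) : complex.Re (\sum_t f t) = \sum_t complex.Re (f t).
Proof. by rewrite (raddf_sum (@complex.Re R)). Qed.

Lemma Re_ext_inner x a b : complex.Re (ext_inner (J x) a b) = re_inner x a b.
Proof.
rewrite ext_innerE Re_sum; apply: eq_bigr => I _.
by case: (a I) (b I) => [a1 a2] [b1 b2] /=; ring.
Qed.

Lemma re_innerC x a b : re_inner x a b = re_inner x b a.
Proof. by apply: eq_bigr => I _; congr (_ * _); ring. Qed.

Lemma re_innerNl x a b : re_inner x (- a) b = - re_inner x a b.
Proof.
rewrite -sumrN; apply: eq_bigr => I _; rewrite ffunE.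
by case: (a I) => [a1 a2] /=; ring.
Qed.

Lemma re_inner_ge0 x a : 0 <= re_inner x a a.
Proof.
apply: sumr_ge0 => I _; rewrite mulr_ge0 ?(ltW (weight_gt0 _ _))//.
by rewrite addr_ge0// -expr2 sqr_ge0.
Qed.

Lemma re_inner_eq0 x a : re_inner x a a = 0 -> a = 0.
Proof.
move=> /eqP; rewrite psumr_eq0 => [/allP H|I _]; last first.
  rewrite mulr_ge0 ?(ltW (weight_gt0 _ _))//.
  by rewrite addr_ge0// -expr2 sqr_ge0.
apply/ffunP => I; have := H I (mem_index_enum I); rewrite implyTb mulf_eq0.
rewrite (gt_eqF (weight_gt0 x I)) orbF -!expr2 paddr_eq0 ?sqr_ge0// !sqrf_eq0 ffunE.
by case: (a I) => a1 a2 /= /andP[/eqP -> /eqP ->].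
Qed.

Lemma re_inner_continuous (a b : form R N) :
  (forall I, contC (fun x => a x I)) -> (forall I, contC (fun x => b x I)) ->
  continuous (fun x => re_inner x (a x) (b x)).
Proof.
move=> ca cb; apply: continuous_bigsum => I; have [ar ai] := ca I; have [br bi] := cb I.
apply: continuous_mul; last exact: weight_continuous.
by apply: continuous_add; exact: continuous_mul.
Qed.

Lemma Re_L2_inner (a b : form R N) :
  complex.Re (L2_inner J a b) = cube_integral (fun x => re_inner x (a x) (b x)).
Proof.
rewrite /L2_inner/=; congr cube_integral; apply/funext => x.
by rewrite Re_ext_inner det_metric sqrtr1 mulr1.
Qed.

(* Pair [dl be + ga = 0] with [al]: [|dl al|^2 + |be|^2 = 0]. *)
Lemma laplacian_eq0 (dl : form R N -> form R N) al :
  smooth_form al -> (forall I, contC (fun x => dl al x I)) ->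
  is_laplacian_value J dl al 0 -> forall x, unit_cube x -> dl al x = 0.
Proof.
move=> sal cdl [be [ga [[sbe Hbe] [sga Hga] E]]] x Cx.
have gaE y : dl be y = - ga y.
  by have := congr1 (@^~ y) E; rewrite addrfctE => /esym/eqP; rewrite addr_eq0 => /eqP.
have E1 := congr1 (@complex.Re R) (Hga _ sal).
have E2 := congr1 (@complex.Re R) (Hbe _ sbe).
rewrite !Re_L2_inner in E1 E2.
have cal I : contC (fun x => al x I) by apply: contC_smooth; exact: sal.2.
have cga I : contC (fun x => ga x I) by apply: contC_smooth; exact: sga.2.
have E3 : cube_integral (fun x => re_inner x (dl be x) (al x))
        = - cube_integral (fun x => re_inner x (al x) (ga x)).
  rewrite -cube_integralN; last exact: re_inner_continuous.
  congr cube_integral; apply/funext => y.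
  by rewrite gaE re_innerNl re_innerC.
have I0 : cube_integral (fun x => re_inner x (dl al x) (dl al x)) = 0.
  apply/eqP; rewrite eq_le; apply/andP; split.
    rewrite E1 -oppr_ge0 -E3 E2; apply: cube_integral_ge0 => y; exact: re_inner_ge0.
  by apply: cube_integral_ge0 => y; exact: re_inner_ge0.
apply: (@re_inner_eq0 x).
apply: (cube_integral_eq0 (re_inner_continuous cdl cdl) _ I0 Cx) => y.
exact: re_inner_ge0.
Qed.

(** Pointwise orthogonality turns both L2 products into integrals of the zero function, so the
    adjoint is found without integrating by parts. *)
Lemma adjoint_value0 (dl : form R N -> form R N) al :
  (forall ga x, smooth_form ga -> ext_inner (J x) (dl ga x) (al x) = 0) ->
  is_adjoint_value J dl al 0.
Proof.
move=> H; split.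
  split=> [i x //|I].
  have -> : (fun x : 'rV[R]_N => (0 : form R N) x I) = fun=> 0.
    by apply/funext => x; rewrite ffunE.
  by split; exact: smooth_cst.
move=> ga sga; rewrite /L2_inner.
have H1 x : ext_inner (J x) (dl ga x) (al x) = 0 by exact: H.
have H2 x : ext_inner (J x) (ga x) ((0 : form R N) x) = 0.
  by rewrite ext_innerE big1// => I _; rewrite ffunE conjc0 mulr0 mul0r.
by rewrite /=; congr Complex; congr cube_integral; apply/funext => x; rewrite H1 H2.
Qed.

End DiagonalMetric.

(** * The almost complex structures *)

Section Pairing.
Variable N : nat.
Hypothesis evenN : ~~ odd N.
Implicit Types i j : 'I_N.

(* The index paired with [i] by [omega_0]; [insubd] never falls back on [i], as
   [N] is even. *)
Definition sigma i : 'I_N := insubd i (if odd i then i.-1 else i.+1).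

Lemma val_sigma i : sigma i = (if odd i then i.-1 else i.+1) :> nat.
Proof.
rewrite val_insubd; case: ifP => //; case: ifPn => [oi|oi].
  by rewrite (leq_ltn_trans (leq_pred _) (ltn_ord i)).
move=> /negbT; rewrite -leqNgt => Ni.
have NE : N = i.+1 by apply/eqP; rewrite eqn_leq Ni ltn_ord.
by have := congr1 odd NE; rewrite /= oi (negbTE evenN).
Qed.

Lemma odd_sigma i : odd (sigma i) = ~~ odd i.
Proof.
rewrite val_sigma; case: (nat_of_ord i) => [|m] //=.
by case E: (odd m); rewrite /= ?E.
Qed.

Lemma sigmaK : involutive sigma.
Proof.
move=> i; apply: val_inj; rewrite /= val_sigma odd_sigma val_sigma.
case: (nat_of_ord i) => [|m] //=.
by case: (odd m).
Qed.

Lemma sigma_neq i : sigma i != i.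
Proof. by apply/eqP => /(congr1 (fun j : 'I_N => odd j)); rewrite odd_sigma; case: odd. Qed.

Lemma sigma_eq i j : (sigma i == j) = (i == sigma j).
Proof. by apply/eqP/eqP => [<-|->]; rewrite sigmaK. Qed.

Variable R : realType.

Definition eps i : R := (-1) ^+ odd i.

Lemma eps_sqr i : eps i * eps i = 1.
Proof. by rewrite /eps -expr2 sqrr_sign. Qed.

Lemma eps_sigma i : eps (sigma i) = - eps i.
Proof. by rewrite /eps odd_sigma; case: odd; rewrite /= ?expr1 ?expr0 ?opprK. Qed.

Lemma omega0E i j : omega0 R N i j = (j == sigma i)%:R * eps i.
Proof.
rewrite mxE -val_eqE /= val_sigma /eps; case: (boolP (odd i)) => [oi|oi]; rewrite /=.
  rewrite sub0r expr1 mulrN1; congr (- (_ : bool)%:R).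
  by case: (val i) oi => //= m _; rewrite eqSS eq_sym.
by rewrite subr0 expr0 mulr1.
Qed.

Lemma sum_sigma (V : zmodType) (F : 'I_N -> V) i :
  (forall k, k != sigma i -> F k = 0) -> \sum_k F k = F (sigma i).
Proof. by move=> F0; rewrite (bigD1 (sigma i))//= big1 ?addr0. Qed.

End Pairing.

Section Structure.
Variables (R : realType) (N : nat).
Hypothesis evenN : ~~ odd N.
Variables (o : 'I_N) (s : 'I_N -> R).
Hypothesis s_sigma : forall i, s (sigma i) = - s i.
Local Notation C := (R[i])%C.
Local Notation vec := 'rV[R]_N.
Implicit Types (x : vec) (i j k l : 'I_N).

(* [J] sends d/dx^j to [dg j] d/dx^{j+1} for even [j], and the metric is diagonal
   with entries [dg i]. *)
Definition dg i x : R := expc o (s i) x.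

Definition Jst x : 'M[R]_N := \matrix_(i, j) - (omega0 R N i j * dg j x).

Lemma dg_gt0 i x : 0 < dg i x.
Proof. exact: expc_gt0. Qed.

Lemma dg_sigma i x : dg (sigma i) x = (dg i x)^-1.
Proof. by rewrite /dg s_sigma expcN. Qed.

Lemma dg_sigmaM i x : dg (sigma i) x * dg i x = 1.
Proof. by rewrite dg_sigma mulVf// gt_eqF// dg_gt0. Qed.

Lemma JstE x i j : Jst x i j = (j == sigma i)%:R * (- eps R i * dg j x).
Proof. by rewrite mxE omega0E//; ring. Qed.

Lemma metric_Jst x : metric (Jst x) = diag_mx (\row_i dg i x).
Proof.
apply/matrixP => i j; rewrite !mxE (sum_sigma (i := i)) => [|k ki].
  rewrite omega0E// eqxx mul1r JstE sigmaK// eps_sigma// opprK mulrCA.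
  rewrite [eps R i * (_ * _)]mulrA eps_sqr mul1r eq_sym.
  by case: eqP => [->|_]; rewrite ?mul1r ?mul0r.
by rewrite omega0E// (negbTE ki) !mul0r.
Qed.

Lemma det_metric_Jst x : \det (metric (Jst x)) = 1.
Proof.
rewrite metric_Jst det_diag; under eq_bigr do rewrite mxE.
set P := \prod_i _.
have P0 : 0 < P by apply: prodr_gt0 => i _; exact: dg_gt0.
(* The involution [sigma] permutes the factors and pairs each of them with its inverse. *)
have PP : P * P = 1.
  rewrite {1}/P (reindex_inj (inv_inj (sigmaK evenN))) /P -big_split big1//= => i _.
  exact: dg_sigmaM.
apply/eqP; rewrite -(@pexpr_eq1 _ _ 2)//; last exact: ltW.
by rewrite expr2 PP.
Qed.

Lemma smooth_Jst i j : smooth (fun x => Jst x i j).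
Proof.
have -> : (fun x => Jst x i j) = cst (- omega0 R N i j) * expc o (s j).
  by apply/funext => x; rewrite mxE mulrfctE mulNr.
by apply: smoothM; [exact: smooth_cst|exact: smooth_expc].
Qed.

Lemma Jst_sqr x : Jst x *m Jst x = - 1%:M.
Proof.
apply/matrixP => i j; rewrite !mxE (sum_sigma (i := i)) => [|k ki].
  rewrite !JstE// sigmaK// eqxx mul1r eps_sigma//; case: (eqVneq i j) => [<-|ij].
    transitivity (- ((eps R i * eps R i) * (dg (sigma i) x * dg i x))).
      by rewrite /= mulr1n; ring.
    by rewrite eps_sqr dg_sigmaM mul1r mulr1n.
  by rewrite mul0r mulr0 mulr0n oppr0.
by rewrite JstE (negbTE ki) !mul0r.
Qed.

Lemma omega0_Jst x (u v : 'cV[R]_N) :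
  omega0_form u (Jst x *m v) = \sum_i dg i x * (u i 0 * v i 0).
Proof.
rewrite /omega0_form mulmxA -[u^T *m _ *m _]mulmxA -/(metric _) metric_Jst mul_mx_diag mxE.
by apply: eq_bigr => i _; rewrite !mxE; ring.
Qed.

Lemma compatible_Jst : omega0_compatible Jst.
Proof.
split; first split.
- by move=> i x; apply/matrixP => k l; rewrite !mxE /dg periodic_expc.
- exact: smooth_Jst.
- exact: Jst_sqr.
- move=> x u u0; rewrite omega0_Jst lt_def; apply/andP; split; last first.
    by apply: sumr_ge0 => i _; rewrite mulr_ge0 ?(ltW (dg_gt0 _ _))// -expr2 sqr_ge0.
  rewrite psumr_eq0 => [|i _]; last first.
    by rewrite mulr_ge0 ?(ltW (dg_gt0 _ _))// -expr2 sqr_ge0.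
  apply: contra u0 => /allP H; apply/eqP/colP => i; rewrite mxE; apply/eqP.
  have := H i (mem_index_enum i); rewrite implyTb mulf_eq0 gt_eqF ?dg_gt0//=.
  by rewrite -expr2 sqrf_eq0.
- by move=> x u v; rewrite !omega0_Jst; apply: eq_bigr => i _; rewrite [v i 0 * _]mulrC.
Qed.

Lemma sum_dx10 x (a : 'I_N -> C) i : \sum_k a k * dx10 (Jst x) k i =
  (a i - 'i%C * (eps R i * dg i x)%:C%C * a (sigma i)) / 2%:R.
Proof.
rewrite /dx10; under eq_bigr do rewrite mulrA mulrBr.
rewrite -mulr_suml sumrB; congr ((_ - _) / _).
  rewrite (bigD1 i)//= big1 => [|k ki]; last by rewrite (negbTE ki) mulr0.
  by rewrite eqxx mulr1 addr0.
rewrite (sum_sigma (i := i)) => [|k ki].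
  by rewrite JstE sigmaK// eqxx mul1r eps_sigma// opprK; ring.
by rewrite JstE eq_sym sigma_eq// (negbTE ki) mul0r; rewrite rmorph0 !mulr0.
Qed.

Lemma sum_dx01 x (a : 'I_N -> C) i : \sum_k a k * dx01 (Jst x) k i =
  (a i + 'i%C * (eps R i * dg i x)%:C%C * a (sigma i)) / 2%:R.
Proof.
rewrite /dx01; under eq_bigr do rewrite mulrA mulrDr.
rewrite -mulr_suml big_split/=; congr ((_ + _) / _).
  rewrite (bigD1 i)//= big1 => [|k ki]; last by rewrite (negbTE ki) mulr0.
  by rewrite eqxx mulr1 addr0.
rewrite (sum_sigma (i := i)) => [|k ki].
  by rewrite JstE sigmaK// eqxx mul1r eps_sigma// opprK; ring.
by rewrite JstE eq_sym sigma_eq// (negbTE ki) mul0r; rewrite rmorph0 !mulr0.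
Qed.

Lemma dual_dx10 x (v : 'I_N -> C) i : dual (dx10 (Jst x)) i v =
  (v i + 'i%C * (eps R i * dg (sigma i) x)%:C%C * v (sigma i)) / 2%:R.
Proof.
rewrite /dual /dx10; under eq_bigr do rewrite mulrAC mulrBl.
rewrite -mulr_suml sumrB -[X in (X + _) / _]addr0; congr ((_ + _) / _).
  rewrite (bigD1 i)//= big1 => [|k ki]; last by rewrite eq_sym (negbTE ki) mul0r.
  by rewrite eqxx mul1r !addr0.
rewrite (sum_sigma (i := i)) => [|k ki].
  by rewrite JstE eqxx mul1r mulNr rmorphN; ring.
by rewrite JstE (negbTE ki) mul0r; rewrite rmorph0 mulr0 mul0r.
Qed.

Lemma dual_dx01 x (v : 'I_N -> C) i : dual (dx01 (Jst x)) i v =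
  (v i - 'i%C * (eps R i * dg (sigma i) x)%:C%C * v (sigma i)) / 2%:R.
Proof.
rewrite /dual /dx01; under eq_bigr do rewrite mulrAC mulrDl.
rewrite -mulr_suml big_split/=; congr ((_ + _) / _).
  rewrite (bigD1 i)//= big1 => [|k ki]; last by rewrite eq_sym (negbTE ki) mul0r.
  by rewrite eqxx mul1r !addr0.
rewrite (sum_sigma (i := i)) => [|k ki].
  by rewrite JstE eqxx mul1r mulNr rmorphN; ring.
by rewrite JstE (negbTE ki) mul0r; rewrite rmorph0 mulr0 mul0r.
Qed.

(** The equation [a \o J = 'i a] for covectors, in coordinates. The coefficient at an even index is
    a multiple of the one at the next odd index, so the odd coefficients determine [a]. *)
Definition coef10 x (a : ext R N) : Prop :=
  (forall I : {set 'I_N}, #|I| != 1%N -> a I = 0) /\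
  forall i, a [set i]%SET = - ('i%C * (eps R i * dg i x)%:C%C * a [set sigma i]%SET).

Lemma halfDD (z : C) : (z + z) / 2%:R = z.
Proof. by rewrite -mulr2n -[z *+ 2]mulr_natr mulfK// pnatr_eq0. Qed.

Lemma coef10P x (a : ext R N) : type_proj (Jst x) 1 0 a = a <-> coef10 x a.
Proof.
have F i : type_proj (Jst x) 1 0 a [set i]%SET =
    (a [set i]%SET - 'i%C * (eps R i * dg i x)%:C%C * a [set sigma i]%SET) / 2%:R.
  by rewrite type_proj10 (sum_dx10 x (fun i => a [set i]%SET)).
split=> [E|[a1 aE]].
  split=> [I I1|i].
    by rewrite -E type_proj_degree.
  have := F i; rewrite E => /(congr1 (fun z => z * 2%:R)).
  rewrite divfK ?pnatr_eq0// mulr_natr mulr2n => /addrI ->.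
  by [].
apply/ffunP => I; have [/cards1P[i ->]|I1] := boolP (#|I| == 1%N); last first.
  by rewrite a1// type_proj_degree.
by rewrite F -aE halfDD.
Qed.

Lemma coef10_proj x (a : ext R N) (p q : int) : coef10 x a ->
  (p, q) != (1, 0) -> type_proj (Jst x) p q a = 0.
Proof.
move=> [a1 aE] pq.
have [/type_proj_neg ->//|] := boolP ((p < 0) || (q < 0)).
rewrite negb_or -!leNgt => /andP[p0 q0].
have [pq1|pq1] := eqVneq (p + q) 1; last exact: (type_proj_degree_src _ a1).
have [p' q'] : p = 0 /\ q = 1.
  move: p q p0 q0 pq1 pq => [[|[|p]]|p] [[|[|q]]|q] //= _ _; by rewrite -PoszD => -[]; lia.
rewrite p' q'; apply/ffunP => I; rewrite ffunE.
have [/cards1P[i ->]|I1] := boolP (#|I| == 1%N); last by rewrite type_proj_degree.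
rewrite type_proj01 (sum_dx01 x (fun i => a [set i]%SET)) aE.
by rewrite addNr mul0r.
Qed.

End Structure.

(** * Forms of type (1,0) annihilated by the Dolbeault operator *)

Section DolbeaultOneForms.
Variables (R : realType) (N : nat).
Hypothesis evenN : ~~ odd N.
Variables (o : 'I_N) (s : 'I_N -> R).
Hypothesis s_sigma : forall i, s (sigma i) = - s i.
Hypothesis even_o : ~~ odd o.
Hypothesis s_o : s o = 0.
Local Notation C := (R[i])%C.
Local Notation vec := 'rV[R]_N.
Local Notation J := (Jst o s).
Local Notation dg := (dg o s).
Implicit Types (x : vec) (i j k l : 'I_N) (al : form R N).

Lemma type_proj0 (M : 'M[R]_N) p q : type_proj M p q 0 = 0.
Proof. by rewrite /type_proj big1// => I _; rewrite ffunE scale0r. Qed.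

Lemma partialC_cst i (c : C) x : partialC i (fun=> c) x = 0.
Proof. by rewrite /partialC !derive_cst. Qed.

Lemma ext_d_const al : (forall x y, al x = al y) -> ext_d al = 0.
Proof.
move=> alc; apply/funext => x; apply/ffunP => K; rewrite !ffunE big1// => i _.
have -> : (fun y => al y (K :\ i)%SET) = (fun=> al x (K :\ i)%SET).
  by apply/funext => y; rewrite (alc y x).
by rewrite partialC_cst mulr0.
Qed.

Lemma ext_d0 : ext_d (0 : form R N) = 0.
Proof. exact: ext_d_const. Qed.

Lemma form_proj0 (M : vec -> 'M[R]_N) p q : form_proj M p q 0 = 0.
Proof. by apply/funext => x; exact: type_proj0. Qed.

Lemma d_component0 (M : vec -> 'M[R]_N) a b : d_component M a b 0 = 0.
Proof.
by rewrite /d_component big1// => p _; rewrite big1// => q _; rewrite form_proj0 ext_d0 form_proj0.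
Qed.

Lemma is_type_coef10 al x : is_type J 1 0 al -> coef10 o s x (al x).
Proof. by move=> [_ E]; apply/(coef10P evenN); exact: (congr1 (@^~ x) E). Qed.

(** All other projections of a (1,0)-form vanish, so a single term of the double sum survives. *)
Lemma d_component10 (a b : int) al : is_type J 1 0 al ->
  d_component J a b al = form_proj J (1 + a) (0 + b) (ext_d al).
Proof.
move=> tal; have z (p q : int) : (p, q) != (1, 0) -> form_proj J p q al = 0.
  move=> pq; apply/funext => x.
  by rewrite [LHS](coef10_proj evenN (is_type_coef10 x tal) pq).
have N0 : (1 < N.+1)%N by rewrite ltnS (leq_ltn_trans _ (ltn_ord o)).
rewrite /d_component (bigD1 (Ordinal N0))//= [X in _ + X]big1 => [|p p1]; last first.
  rewrite big1// => q _; rewrite z ?ext_d0 ?form_proj0//.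
  by apply: contra p1; rewrite xpair_eqE => /andP[+ _]; rewrite eqz_nat -val_eqE.
rewrite addr0 (bigD1 ord0)//= [X in _ + X]big1 => [|q q0]; last first.
  by rewrite z ?ext_d0 ?form_proj0.
by rewrite addr0 tal.2.
Qed.

Lemma altco_ext_d al x i j : altco (ext_d al x) i j =
  partialC i (fun y => al y [set j]%SET) x - partialC j (fun y => al y [set i]%SET) x.
Proof.
rewrite (altco_sum (F := fun i K => partialC i (fun y => al y K) x))// => K.
by rewrite ffunE.
Qed.

(** For even [j] this is [d_j - 'i J d_j], a vector of type (1,0); [antiholo_vec] is its
    conjugate. *)
Definition holo_vec j x k : C := (k == j)%:R - 'i%C * (dg j x)%:C%C * (k == sigma j)%:R.

Definition antiholo_vec j x k : C := (k == j)%:R + 'i%C * (dg j x)%:C%C * (k == sigma j)%:R.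

Lemma eps_even j : ~~ odd j -> eps R j = 1.
Proof. by rewrite /eps => /negbTE ->. Qed.

Lemma sqr_imag : 'i%C * 'i%C = -1 :> C.
Proof. by rewrite -expr2 sqr_i. Qed.

Lemma holo_vec_sigma j x k : ~~ odd j ->
  'i%C * (eps R k * dg (sigma k) x)%:C%C * holo_vec j x (sigma k) = holo_vec j x k.
Proof.
move=> ej; rewrite /holo_vec (inj_eq (inv_inj (sigmaK evenN))) sigma_eq//.
have [->|kj] := eqVneq k j.
  rewrite eq_sym (negbTE (sigma_neq evenN j)) eps_even// mul1r /= !mulr1 sub0r.
  rewrite mulrN mulrACA sqr_imag mulN1r opprK -rmorphM/= (dg_sigmaM o s_sigma).
  by rewrite mulr0 subr0.
have [->|ksj] := eqVneq k (sigma j); last by rewrite !mulr0 subr0 mulr0.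
rewrite eps_sigma// eps_even// sigmaK// mulN1r /= mulr0 subr0 !mulr1 sub0r.
by rewrite rmorphN mulrN.
Qed.

Lemma antiholo_vec_sigma j x k : ~~ odd j ->
  'i%C * (eps R k * dg (sigma k) x)%:C%C * antiholo_vec j x (sigma k) = - antiholo_vec j x k.
Proof.
move=> ej; rewrite /antiholo_vec (inj_eq (inv_inj (sigmaK evenN))) sigma_eq//.
have [->|kj] := eqVneq k j.
  rewrite eq_sym (negbTE (sigma_neq evenN j)) eps_even// mul1r /= !mulr1 add0r.
  rewrite mulrACA sqr_imag mulN1r -rmorphM/= (dg_sigmaM o s_sigma).
  by rewrite mulr0 addr0.
have [->|ksj] := eqVneq k (sigma j); last by rewrite !mulr0 addr0 mulr0 oppr0.
rewrite eps_sigma// eps_even// sigmaK// mulN1r /= mulr0 addr0 !mulr1 add0r.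
by rewrite rmorphN mulrN.
Qed.

Lemma sum_holo_vec j x (F : 'I_N -> C) : \sum_k F k * holo_vec j x k =
  F j - 'i%C * (dg j x)%:C%C * F (sigma j).
Proof.
rewrite /holo_vec; under eq_bigr do rewrite mulrBr; rewrite sumrB; congr (_ - _).
  by rewrite (bigD1 j)//= big1 => [|k kj]; rewrite ?eqxx ?mulr1 ?addr0// (negbTE kj) mulr0.
rewrite (bigD1 (sigma j))//= big1 => [|k kj]; last by rewrite (negbTE kj) !mulr0.
by rewrite eqxx mulr1 addr0 mulrC.
Qed.

Lemma sum_antiholo_vec j x (F : 'I_N -> C) : \sum_k F k * antiholo_vec j x k =
  F j + 'i%C * (dg j x)%:C%C * F (sigma j).
Proof.
rewrite /antiholo_vec; under eq_bigr do rewrite mulrDr; rewrite big_split/=; congr (_ + _).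
  by rewrite (bigD1 j)//= big1 => [|k kj]; rewrite ?eqxx ?mulr1 ?addr0// (negbTE kj) mulr0.
rewrite (bigD1 (sigma j))//= big1 => [|k kj]; last by rewrite (negbTE kj) !mulr0.
by rewrite eqxx mulr1 addr0 mulrC.
Qed.

Lemma ev_holo a x j l : ev a (holo_vec j x) (antiholo_vec l x) =
  altco a j l + 'i%C * (dg l x)%:C%C * altco a j (sigma l)
  - 'i%C * (dg j x)%:C%C *
    (altco a (sigma j) l + 'i%C * (dg l x)%:C%C * altco a (sigma j) (sigma l)).
Proof.
rewrite -!sum_antiholo_vec -(sum_holo_vec j x (fun i => \sum_k altco a i k * antiholo_vec l x k)).
apply: eq_bigr => i _; rewrite mulr_suml; apply: eq_bigr => k _.
by rewrite [holo_vec _ _ _ * _]mulrC mulrA.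
Qed.

(** Vectors of types (1,0) and (0,1) together see only the (1,1) part of [d al], which is
    [delbar al]. *)
Lemma delbar_ev al x j l : is_type J 1 0 al -> d_delbar J al x = 0 ->
  ~~ odd j -> ~~ odd l -> ev (ext_d al x) (holo_vec j x) (antiholo_vec l x) = 0.
Proof.
move=> tal; rewrite /d_delbar d_component10// addr0 add0r => D0 ej el.
rewrite -(@ev_type_proj11 _ _ (J x)).
- by rewrite [type_proj _ _ _ _]D0 ev_degree// => K _; rewrite ffunE.
- by move=> i; rewrite dual_dx10// holo_vec_sigma// halfDD.
- by move=> i; rewrite dual_dx01// holo_vec_sigma// subrr mul0r.
- by move=> i; rewrite dual_dx10// antiholo_vec_sigma// subrr mul0r.
- by move=> i; rewrite dual_dx01// antiholo_vec_sigma// opprK halfDD.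
Qed.

Definition reco al j x : R := complex.Re (al x [set sigma j]%SET).
Definition imco al j x : R := complex.Im (al x [set sigma j]%SET).

Lemma smooth_reco al j : smooth_form al -> smooth (reco al j).
Proof. by move=> [_ /(_ [set sigma j]%SET)[]]. Qed.

Lemma smooth_imco al j : smooth_form al -> smooth (imco al j).
Proof. by move=> [_ /(_ [set sigma j]%SET)[]]. Qed.

Lemma periodic_reco al j : smooth_form al -> periodic (reco al j).
Proof. by move=> [pal _] i x; rewrite /reco pal. Qed.

Lemma periodic_imco al j : smooth_form al -> periodic (imco al j).
Proof. by move=> [pal _] i x; rewrite /imco pal. Qed.

Lemma partialCE k (f : vec -> C) x : partialC k f x =
  Complex (pd k (fun y => complex.Re (f y)) x) (pd k (fun y => complex.Im (f y)) x).
Proof. by rewrite !pdE. Qed.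

Lemma partialC_sigma al j k x : partialC k (fun y => al y [set sigma j]%SET) x =
  Complex (pd k (reco al j) x) (pd k (imco al j) x).
Proof. exact: partialCE. Qed.

Lemma pd_dg k j x : pd k (dg j) x = (k == o)%:R * (- (2 * pi * s j) * sinc o x * dg j x).
Proof. by rewrite pdE; have [_ ->] := is_derive_expc o (s j) k x. Qed.

Lemma partialC_even al j k x : is_type J 1 0 al -> ~~ odd j ->
  partialC k (fun y => al y [set j]%SET) x =
  Complex (dg j x * pd k (imco al j) x + imco al j x * pd k (dg j) x)
    (- (dg j x * pd k (reco al j) x + reco al j x * pd k (dg j) x)).
Proof.
move=> tal ej; have sal := tal.1.
have E y : al y [set j]%SET = Complex (dg j y * imco al j y) (- (dg j y * reco al j y)).
  have [_ ->] := is_type_coef10 y tal; rewrite eps_even// mul1r /imco /reco.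
  by case: (al y _) => a b /=; congr Complex; ring.
rewrite partialCE.
have sd : smooth (dg j) by exact: smooth_expc.
have sr := smooth_reco j sal; have si := smooth_imco j sal.
have -> : (fun y => complex.Re (al y [set j]%SET)) = dg j * imco al j.
  by apply/funext => y; rewrite E.
have -> : (fun y => complex.Im (al y [set j]%SET)) = - (dg j * reco al j).
  by apply/funext => y; rewrite E.
have dgr := smooth_derivable k x (smoothM sd sr).
have -> : pd k (- (dg j * reco al j)) x = - pd k (dg j * reco al j) x.
  by rewrite !pdE deriveN.
have dd := smooth_derivable k x sd; have dr := smooth_derivable k x sr.
have di := smooth_derivable k x si.
by rewrite (pdM dd di) (pdM dd dr).
Qed.

(* Evaluating d al on the vectors d_j - i g_j d_{j+1} and d_l + i g_l d_{l+1}, with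
   g = dg, and splitting 2 g_j (d_l + i g_l d_{l+1}) b_j = (d_j g_l) b_l - (d_l g_j) b_j
   into real and imaginary parts, where b_j is the coefficient of dx^{j+1}. *)
Lemma delbar_pde al x j l : is_type J 1 0 al -> d_delbar J al x = 0 ->
  ~~ odd j -> ~~ odd l ->
  2 * dg j x * (pd l (reco al j) x - dg l x * pd (sigma l) (imco al j) x) =
    pd j (dg l) x * reco al l x - pd l (dg j) x * reco al j x /\
  2 * dg j x * (pd l (imco al j) x + dg l x * pd (sigma l) (reco al j) x) =
    pd j (dg l) x * imco al l x - pd l (dg j) x * imco al j x.
Proof.
move=> tal D0 ej el; have := delbar_ev tal D0 ej el.
rewrite ev_holo !altco_ext_d !partialC_sigma !(partialC_even _ _ tal)//.
(* [sigma k] is odd and [o] is even, so no [dg] varies in the directions [sigma j] and [sigma l]. *)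
have so k : ~~ odd k -> (sigma k == o) = false.
  move=> ek; apply/negP => /eqP E; have := odd_sigma evenN k.
  by rewrite E (negbTE even_o) ek.
rewrite !(pd_dg (sigma _)) !so// !mul0r !mulr0 !addr0.
move: (pd l (reco al j) x) (pd l (imco al j) x) (pd (sigma l) (reco al j) x)
  (pd (sigma l) (imco al j) x) (pd j (reco al l) x) (pd j (imco al l) x)
  (pd (sigma j) (reco al l) x) (pd (sigma j) (imco al l) x) (pd j (dg l) x)
  (pd l (dg j) x) (dg j x) (dg l x) (reco al j x) (reco al l x) (imco al j x) (imco al l x).
move=> a1 a2 a3 a4 a5 a6 a7 a8 a9 a10 a11 a12 a13 a14 a15 a16.
move=> /eqP; rewrite eq_complex /= => /andP[/eqP E1 /eqP E2].
(* The imaginary part of the evaluation is the first equation, the real part is the negative of the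
   second. *)
split; apply/eqP; rewrite -subr_eq0.
  by rewrite -[X in _ == X]E2; apply/eqP; ring.
by rewrite -[X in _ == X]oppr0 -[X in _ == - X]E1; apply/eqP; ring.
Qed.

End DolbeaultOneForms.

(** * Constancy and vanishing of the coefficients *)

Section ClosedOneForms.
Variables (R : realType) (N : nat).
Hypothesis evenN : ~~ odd N.
Variables (o : 'I_N) (s : 'I_N -> R).
Hypothesis s_sigma : forall i, s (sigma i) = - s i.
Hypothesis even_o : ~~ odd o.
Hypothesis s_o : s o = 0.
Local Notation vec := 'rV[R]_N.
Local Notation J := (Jst o s).
Local Notation dg := (dg o s).
Implicit Types (x : vec) (i j k l : 'I_N).

Lemma D_vanishes_cst (c : R) k : D_vanishes k (fun _ : vec => c).
Proof. by move=> x; split; [exact: derivable_cst|exact: pd_cst]. Qed.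

Lemma D_vanishesM (f g : vec -> R) k :
  D_vanishes k f -> D_vanishes k g -> D_vanishes k (f * g).
Proof.
move=> Df Dg x; have [df f0] := Df x; have [dg g0] := Dg x.
by split; [exact: (derivableM df dg)|rewrite (pdM df dg) f0 g0 !mulr0 addr0].
Qed.

Lemma D_vanishes_dg k l : (k == o) && (s l != 0) = false -> D_vanishes k (dg l).
Proof.
move=> kl x; split; first exact: (smooth_derivable k x (smooth_expc o (s l))).
rewrite pd_dg; case: eqP kl => [_|_ _]; last by rewrite mul0r.
by case: eqP => // -> _; rewrite !(mulr0, oppr0, mul0r).
Qed.

Lemma D_vanishes_sinc k : k != o -> D_vanishes k (sinc o : vec -> R).
Proof.
by move=> ko x; have [ds Ds] := is_derive_sinc o k x; split => //; rewrite pdE Ds (negbTE ko) mul0r.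
Qed.

Variable al : form R N.
Hypothesis al_type : is_type J 1 0 al.
Hypothesis al_closed : forall x, d_delbar J al x = 0.
Local Notation u := (reco al).
Local Notation v := (imco al).

Lemma sigma_neq_o k : ~~ odd k -> sigma k != o.
Proof. by move=> ek; apply: contra even_o => /eqP <-; rewrite odd_sigma. Qed.

Let dg_nz j x : 2 * dg j x != 0.
Proof. by rewrite mulf_neq0 ?pnatr_eq0// gt_eqF// dg_gt0. Qed.

Let su j : smooth (u j) := smooth_reco j al_type.1.
Let sv j : smooth (v j) := smooth_imco j al_type.1.
Let pu j : periodic (u j) := periodic_reco j al_type.1.
Let pv j : periodic (v j) := periodic_imco j al_type.1.

Definition flat j l := forall x, [/\ pd l (u j) x = 0, pd (sigma l) (u j) x = 0,
  pd l (v j) x = 0 & pd (sigma l) (v j) x = 0].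

(** Here [p] and [q] are the right-hand sides divided by [2 g_j]. That they vanish once they are
    constant along the plane is the source of the relations [(d_o g_l) b_l = 0]. *)
Lemma flat_of_pde j l (p q : vec -> R) : ~~ odd j -> ~~ odd l ->
  (forall k, k \in [:: l; sigma l] ->
    [/\ D_vanishes k (dg l), D_vanishes k p & D_vanishes k q]) ->
  (forall x, pd j (dg l) x * u l x - pd l (dg j) x * u j x = 2 * dg j x * p x) ->
  (forall x, pd j (dg l) x * v l x - pd l (dg j) x * v j x = 2 * dg j x * q x) ->
  flat j l /\ forall x, p x = 0 /\ q x = 0.
Proof.
move=> ej el Dv Ep Eq.
have E1 x : pd l (u j) x = dg l x * pd (sigma l) (v j) x + p x.
  have [+ _] := delbar_pde evenN s_sigma even_o al_type (al_closed x) ej el.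
  by rewrite Ep => /(mulfI (dg_nz j x)) <-; rewrite addrC subrK.
have E2 x : pd l (v j) x = - (dg l x * pd (sigma l) (u j) x) + q x.
  have [_ +] := delbar_pde evenN s_sigma even_o al_type (al_closed x) ej el.
  by rewrite Eq => /(mulfI (dg_nz j x)) <-; rewrite addrC addrK.
have F : flat j l.
  exact: (periodic_Liouville (su j) (sv j) (pu j) (pv j) (@dg_gt0 _ _ o s l) Dv E1 E2).
split=> // x; have [f1 f2 f3 f4] := F x.
by have := E1 x; have := E2 x; rewrite f1 f2 f3 f4 !mulr0 oppr0 !add0r.
Qed.

(** No [dg] varies in the directions [j] and [l], so the system is homogeneous. *)
Lemma flat_off j l : ~~ odd j -> ~~ odd l -> j != o -> l != o -> flat j l.
Proof.
move=> ej el jo lo.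
have [] // := @flat_of_pde j l (fun=> 0) (fun=> 0) ej el.
- move=> k; rewrite !inE => klo; split; [|exact: D_vanishes_cst..].
  apply: D_vanishes_dg; suff -> : (k == o) = false by [].
  by apply/negbTE; case/orP: klo => /eqP ->//; exact: sigma_neq_o.
- by move=> x; rewrite !pd_dg (negbTE jo) (negbTE lo) !mul0r mulr0 subr0.
- by move=> x; rewrite !pd_dg (negbTE jo) (negbTE lo) !mul0r mulr0 subr0.
Qed.

(* The right-hand side is constant along the plane of [l], so it must vanish. *)
Lemma flat_o l : ~~ odd l -> l != o ->
  flat o l /\ forall x, pd o (dg l) x * u l x = 0 /\ pd o (dg l) x * v l x = 0.
Proof.
move=> el lo; have F := flat_off el el lo lo.
have klo k : k \in [:: l; sigma l] -> k != o.
  by rewrite !inE => /orP[] /eqP ->//; exact: sigma_neq_o.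
(* Half of [(d_o g_l) w], as the divisor [2 g_o] is [2]. The derivative is written out so that each
   factor is visibly constant along the plane of [l]. *)
pose p (w : vec -> R) := (fun _ : vec => - (pi * s l)) * (sinc o * (dg l * w)).
have Dp w k : smooth w -> k \in [:: l; sigma l] -> (forall x, pd k w x = 0) ->
    D_vanishes k (p w).
  move=> sw kl w0; apply: D_vanishesM; first exact: D_vanishes_cst.
  apply: D_vanishesM; first exact/D_vanishes_sinc/klo.
  apply: D_vanishesM; first by apply: D_vanishes_dg; rewrite (negbTE (klo _ kl)).
  by move=> x; split => //; exact: smooth_derivable.
have pE w x : pd o (dg l) x * w x = 2 * p w x.
  by rewrite pd_dg eqxx /p !mulrfctE/=; ring.
have pE' w x : pd o (dg l) x * w l x - pd l (dg o) x * w o x = 2 * dg o x * p (w l) x.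
  rewrite pE [X in _ - X * _]pd_dg (negbTE lo) !mul0r subr0.
  by rewrite /dg s_o expc0 mulr1.
have [|||F' pq] := @flat_of_pde o l (p (u l)) (p (v l)) even_o el.
- move=> k kl; split; first by apply: D_vanishes_dg; rewrite (negbTE (klo _ kl)).
    apply: Dp => // x; have [? ? _ _] := F x.
    by move: kl; rewrite !inE => /orP[] /eqP ->.
  apply: Dp => // x; have [_ _ ? ?] := F x.
  by move: kl; rewrite !inE => /orP[] /eqP ->.
- by move=> x; exact: (pE' u).
- by move=> x; exact: (pE' v).
split=> // x; have [p0 q0] := pq x.
by rewrite !pE p0 q0 mulr0.
Qed.

Lemma pd_dg_coef j x : ~~ odd j ->
  pd o (dg j) x * u j x = 0 /\ pd o (dg j) x * v j x = 0.
Proof.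
move=> ej; have [->|jo] := eqVneq j o; last by have [_] := flat_o ej jo.
by rewrite pd_dg s_o !(mulr0, oppr0, mul0r).
Qed.

(** The term [(d_o g_j) b_j] of the right-hand side, a priori not constant along this plane, is zero
    by [pd_dg_coef]. *)
Lemma flat_at_o j : ~~ odd j -> flat j o.
Proof.
move=> ej; have [] // := @flat_of_pde j o (fun=> 0) (fun=> 0) ej even_o.
- move=> k _; split; [|exact: D_vanishes_cst..].
  by apply: D_vanishes_dg; rewrite s_o eqxx andbF.
- move=> x; have [-> _] := pd_dg_coef x ej.
  by rewrite pd_dg s_o !(mulr0, oppr0, mul0r) addr0.
- move=> x; have [_ ->] := pd_dg_coef x ej.
  by rewrite pd_dg s_o !(mulr0, oppr0, mul0r) addr0.
Qed.

Lemma flat_all j l : ~~ odd j -> ~~ odd l -> flat j l.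
Proof.
move=> ej el; have [->|lo] := eqVneq l o; first exact: flat_at_o.
have [->|jo] := eqVneq j o; first by have [] := flat_o el lo.
exact: flat_off.
Qed.

Lemma pd_coef j k x : ~~ odd j -> pd k (u j) x = 0 /\ pd k (v j) x = 0.
Proof.
move=> ej; have [ok|ek] := boolP (odd k); last by have [] := flat_all ej ek x.
have es : ~~ odd (sigma k) by rewrite odd_sigma ?negbK.
by have [] := flat_all ej es x; rewrite sigmaK.
Qed.

Lemma coef_const j x y : ~~ odd j -> al x [set sigma j]%SET = al y [set sigma j]%SET.
Proof.
move=> ej; have isd (w : vec -> R) k z : smooth w -> pd k w z = 0 -> is_derive z (evec R k) w 0.
  by move=> sw; rewrite pdE => w0; split => //; exact: smooth_derivable.
have Eu : u j x = u j y.
  by apply: const_of_D0 => k z; apply: isd => //; have [] := pd_coef k z ej.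
have Ev : v j x = v j y.
  by apply: const_of_D0 => k z; apply: isd => //; have [] := pd_coef k z ej.
by move: Eu Ev; rewrite /reco /imco; case: (al x _) (al y _) => a b [c d] /= -> ->.
Qed.

Lemma coef_eq0 j x : ~~ odd j -> s j != 0 -> al x [set sigma j]%SET = 0.
Proof.
(* At [x_o = 1 / 4] the sine equals one, so the derivative of [g_j] is nonzero there. *)
move=> ej sj; rewrite (coef_const x (4^-1 *: evec R o) ej).
set z := _ *: _.
have nz : pd o (dg j) z != 0.
  have -> : pd o (dg j) z = - (2 * pi * s j) * dg j z.
    rewrite pd_dg eqxx mul1r /sinc !mxE !eqxx mulr1.
    have -> : 2 * pi * 4^-1 = pi / 2 :> R by field.
    by rewrite sin_pihalf mulr1.
  rewrite mulf_neq0// ?(gt_eqF (dg_gt0 _ _ _ _))// oppr_eq0 !mulf_neq0//.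
  by rewrite gt_eqF// pi_gt0.
have [/eqP + /eqP] := pd_dg_coef z ej.
rewrite !mulf_eq0 (negbTE nz) /= /reco /imco; case: (al z _) => a b /= /eqP -> /eqP ->.
by [].
Qed.

End ClosedOneForms.

(** * Hodge numbers *)

Section Dimension.
Variables (R : realType) (N : nat).
Local Notation C := (R[i])%C.

Lemma lincombE n (c : 'I_n -> C) (e : 'I_n -> form R N) x K :
  (\sum_(i < n) c i *: e i) x K = \sum_(i < n) c i * e i x K.
Proof.
rewrite fct_sumE sum_ffunE; apply: eq_bigr => i _.
by rewrite -[(c i *: e i) x]/(c i *: e i x) ffunE.
Qed.

(** With more than [m] forms in a family, the matrix of their coordinates has a nonzero left kernel,
    which supplies a linear relation among them. *)
Lemma sq_dim_eq (X : subquotient R N) m (e : 'I_m -> form R N) :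
  (forall i, sq_num X (e i)) ->
  (forall c : 'I_m -> C, sq_den X (\sum_i c i *: e i) -> forall i, c i = 0) ->
  sq_den X 0 ->
  (forall al, sq_num X al -> exists c : 'I_m -> C, al = \sum_i c i *: e i) ->
  sq_dim X = (m%:R)%:E.
Proof.
move=> num_e free_e den0 span_e; apply/eqP; rewrite eq_le; apply/andP; split; last first.
  by apply: ereal_sup_ubound; exists m => //; exists e.
apply: ge_ereal_sup => _ [k [v [num_v free_v]] <-].
rewrite lee_fin ler_nat leqNgt; apply/negP => mk.
have [A vA] : exists A : 'M[C]_(k, m), forall i, v i = \sum_j A i j *: e j.
  have [A vA] := choice (fun i => span_e _ (num_v i)).
  by exists (\matrix_(i, j) A i j) => i; rewrite vA; apply: eq_bigr => j _; rewrite mxE.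
have : kermx A != 0.
  rewrite kermx_eq0 /row_free neq_ltn; apply/orP; left.
  by rewrite (leq_ltn_trans (rank_leq_col A)).
move=> /rowV0Pn[w /sub_kermxP wA w0]; case/eqP: w0; apply/rowP => i; rewrite mxE.
apply: (free_v (fun i => w 0 i)).
suff -> : \sum_(i < k) w 0 i *: v i = 0 by [].
apply/funext => x; apply/ffunP => K; rewrite lincombE ffunE.
under eq_bigr => j _ do rewrite vA lincombE mulr_sumr.
rewrite exchange_big/= big1// => j _.
under eq_bigr do rewrite mulrA.
have := congr1 (fun M : 'rV[C]_m => M 0 j) wA; rewrite !mxE => E.
by rewrite -mulr_suml E mul0r.
Qed.

Lemma smooth_form_const (a : ext R N) : smooth_form (fun=> a).
Proof. by split=> // I; split; exact: smooth_cst. Qed.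

Definition dx_form (i : 'I_N) : form R N :=
  fun=> [ffun K : {set 'I_N} => (K == [set i]%SET)%:R].

(** The [dx^i] are independent modulo exact forms: if a combination of them is [d f], then [f] is
    periodic with constant partial derivatives, and these are zero by the mean value theorem over
    one period. *)
Lemma betti1_ge : (N%:R%:E <= betti R N 1)%E.
Proof.
apply: ereal_sup_ubound; exists N => //; exists dx_form; split.
  move=> i; split; last exact: ext_d_const.
  split=> [|x I I1]; first exact: smooth_form_const.
  rewrite ffunE (_ : (I == [set i]%SET) = false)//.
  by apply: contraNF I1 => /eqP ->; rewrite cards1.
move=> c [be [ga [[[pbe sbe] _] ga0 E]]] i.
have E1 x : partialC i (fun y => be y finset.set0) x = c i.
  have := congr1 (fun al : form R N => al x [set i]%SET) E.
  rewrite ga0 addr0 lincombE (bigD1 i)//= big1 => [|k ki]; last first.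
    by rewrite ffunE (inj_eq finset.set1_inj) eq_sym (negbTE ki) mulr0.
  rewrite ffunE eqxx mulr1 addr0 ffunE big_set1 finset.setDv => ->.
  rewrite (_ : [set j in _ | _]%SET = finset.set0) ?cards0 ?expr0 ?mul1r//.
  by apply/finset.setP => k; rewrite !inE; case: eqP => // ->; rewrite ltnn.
have [sr si] := sbe finset.set0.
have D0 (f : 'rV[R]_N -> R) a : smooth f -> periodic f ->
    (forall x, 'D_(evec R i) f x = a) -> a = 0.
  move=> sf pf fa.
  have [t _] := MVT_line 0 (fun y => smooth_derivable i y sf) (smooth_continuous sf) ltr01.
  by rewrite fa scale1r [evec R i + 0]addrC pf subrr mul1r.
have pr : periodic (fun y => complex.Re (be y finset.set0)) by move=> k x; rewrite pbe.
have pi_ : periodic (fun y => complex.Im (be y finset.set0)) by move=> k x; rewrite pbe.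
have r0 := D0 _ (complex.Re (c i)) sr pr (fun x => congr1 (@complex.Re R) (E1 x)).
have i0 := D0 _ (complex.Im (c i)) si pi_ (fun x => congr1 (@complex.Im R) (E1 x)).
by move: r0 i0; case: (c i) => a b /= -> ->.
Qed.

End Dimension.

(** * The two Hodge numbers as the number of untwisted pairs *)

Section HodgeNumbers.
Variables (R : realType) (N : nat).
Hypothesis evenN : ~~ odd N.
Variables (o : 'I_N) (s : 'I_N -> R).
Hypothesis s_sigma : forall i, s (sigma i) = - s i.
Hypothesis even_o : ~~ odd o.
Hypothesis s_o : s o = 0.
Local Notation C := (R[i])%C.
Local Notation vec := 'rV[R]_N.
Local Notation J := (Jst o s).
Local Notation dg := (dg o s).
Implicit Types (x : vec) (i j : 'I_N).

Definition free_pairs : {set 'I_N} := [set j : 'I_N | ~~ odd j && (s j == 0)]%SET.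

(* The form [dx^{j+1} - i dx^j = - i (dx^j + i dx^{j+1})]. *)
Definition dz_form j : form R N := fun=>
  [ffun K : {set 'I_N} => (K == [set sigma j]%SET)%:R - 'i%C * (K == [set j]%SET)%:R].

Lemma dz_form1 j x i : dz_form j x [set i]%SET = (i == sigma j)%:R - 'i%C * (i == j)%:R.
Proof. by rewrite ffunE !(inj_eq finset.set1_inj). Qed.

Lemma dz_form_coef10 j x : j \in free_pairs -> coef10 o s x (dz_form j x).
Proof.
rewrite inE => /andP[ej /eqP sj]; split=> [I I1|i].
  have nI k : (I == [set k]%SET) = false.
    by apply: contraNF I1 => /eqP ->; rewrite cards1.
  by rewrite ffunE !nI mulr0 subr0.
rewrite !dz_form1 (inj_eq (inv_inj (sigmaK evenN))) sigma_eq//.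
have [->|ij] := eqVneq i j.
  rewrite eq_sym (negbTE (sigma_neq evenN j)) eps_even// /dg sj expc0 !mulr1 /=.
  by rewrite sub0r mulr0 subr0 mulr1.
have [->|isj] := eqVneq i (sigma j); last by rewrite mulr0 subrr mulr0 oppr0.
rewrite eps_sigma// eps_even// /dg s_sigma sj oppr0 expc0 mulr1 mulr0 subr0 sub0r mulr1.
by rewrite rmorphN1 mulrN1 mulNr mulrN opprK sqr_imag opprK.
Qed.

Lemma dz_form_type j : j \in free_pairs -> is_type J 1 0 (dz_form j).
Proof.
move=> Lj; split; first exact: smooth_form_const.
by apply/funext => x; apply/coef10P => //; exact: dz_form_coef10.
Qed.

Lemma d_component_dz j a b : j \in free_pairs -> d_component J a b (dz_form j) = 0.
Proof.
move=> Lj; rewrite (d_component10 evenN a b (dz_form_type Lj)).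
by rewrite ext_d_const ?form_proj0.
Qed.

Let e (k : 'I_#|free_pairs|) : form R N := dz_form (enum_val k).

Lemma dz_free (c : 'I_#|free_pairs| -> C) :
  \sum_k c k *: e k = 0 -> forall k, c k = 0.
Proof.
move=> E k; have := congr1 (fun al : form R N => al 0 [set sigma (enum_val k)]%SET) E.
rewrite lincombE ffunE (bigD1 k)//= big1 => [|l lk].
  rewrite dz_form1 eqxx (negbTE (sigma_neq evenN _)) mulr0 subr0 mulr1 addr0.
  by [].
rewrite dz_form1 (inj_eq (inv_inj (sigmaK evenN))) (inj_eq enum_val_inj) eq_sym (negbTE lk).
have /negbTE -> : sigma (enum_val k) != enum_val l.
  apply/negP => /eqP E'; have := enum_valP k; have := enum_valP l.
  by rewrite -E' !inE odd_sigma// => /andP[/negbNE ->].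
by rewrite mulr0 subr0 mulr0.
Qed.

(** The coefficients at odd indices are constant by [coef_const] and vanish off the free pairs by
    [coef_eq0]; those at even indices follow from the type condition. *)
Lemma dz_span al : is_type J 1 0 al -> (forall x, d_delbar J al x = 0) ->
  exists c : 'I_#|free_pairs| -> C, al = \sum_k c k *: e k.
Proof.
move=> tal D0; exists (fun k => al 0 [set sigma (enum_val k)]%SET).
have cst := coef_const evenN s_sigma even_o s_o tal D0.
have zero := coef_eq0 evenN s_sigma even_o s_o tal D0.
apply/funext => x; apply/ffunP => K; rewrite lincombE.
have [a1 aE] := is_type_coef10 evenN x tal.
have [/cards1P[i ->]|K1] := boolP (#|K| == 1%N); last first.
  rewrite a1// big1// => k _; rewrite /e.
  by have [-> //] := dz_form_coef10 x (enum_valP k); rewrite mulr0.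
rewrite -(big_enum_val (fun j => al 0 [set sigma j]%SET * dz_form j x [set i]%SET)).
under eq_bigr do rewrite dz_form1.
have [oi|ei] := boolP (odd i).
  have esi : ~~ odd (sigma i) by rewrite odd_sigma// negbK.
  have F j : j \in free_pairs -> j != sigma i ->
      al 0 [set sigma j]%SET * ((i == sigma j)%:R - 'i%C * (i == j)%:R) = 0.
    rewrite inE => /andP[ej _] ji; rewrite -sigma_eq// eq_sym (negbTE ji).
    have /negbTE -> : i != j by apply: contraNneq ej => <-.
    by rewrite mulr0 subr0 mulr0.
  have [si|si] := boolP (sigma i \in free_pairs).
    rewrite (bigD1 (sigma i))//= big1 => [|j /andP[]]; last exact: F.
    rewrite sigmaK// eqxx eq_sym (negbTE (sigma_neq evenN i)) mulr0 subr0 mulr1 addr0.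
    by have := cst (sigma i) x 0 esi; rewrite sigmaK.
  rewrite big1 => [|j Lj]; last by apply: F => //; apply: contraNneq si => <-.
  have := zero (sigma i) x esi; rewrite sigmaK//; apply.
  by move: si; rewrite inE esi.
have F j : j \in free_pairs -> j != i ->
    al 0 [set sigma j]%SET * ((i == sigma j)%:R - 'i%C * (i == j)%:R) = 0.
  rewrite inE => /andP[ej _] ji; rewrite [i == j]eq_sym (negbTE ji).
  have /negbTE -> : i != sigma j by apply: contraNneq ei => ->; rewrite odd_sigma.
  by rewrite mulr0 subr0 mulr0.
rewrite aE eps_even// mul1r.
have [Li|Li] := boolP (i \in free_pairs).
  rewrite (bigD1 i)//= big1 => [|j /andP[]]; last exact: F.
  rewrite eqxx eq_sym (negbTE (sigma_neq evenN i)) addr0 mulr1 sub0r (cst i x 0 ei).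
  move: Li; rewrite inE => /andP[_ /eqP si]; rewrite /dg si expc0 mulr1.
  by rewrite mulrN mulrC.
rewrite big1 => [|j Lj]; last by apply: F => //; apply: contraNneq Li => <-.
rewrite zero ?mulr0 ?oppr0//.
by move: Li; rewrite inE ei.
Qed.

Lemma is_type_neg p q al : (p < 0) || (q < 0) -> is_type J p q al -> al = 0.
Proof. by move=> pq [_ <-]; apply/funext => x; exact: type_proj_neg. Qed.

Lemma is_type0 p q : is_type J p q 0.
Proof. by split; [exact: smooth_form_const|exact: form_proj0]. Qed.

(** Bidegrees (1,-1), (2,-2) and (2,-1) contain only the zero form, so every quotient involved is by
    zero and the space is the common kernel of [mubar] and [delbar]. *)
Lemma h_Dol10 : h_Dol J 1 0 = (#|free_pairs|%:R)%:E.
Proof.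
have den0 : sq_den (H_mubar J 1 (0 + 1)) 0.
  exists 0, 0; split; [exact: is_type0|by []|].
  by rewrite /d_mubar d_component0 addr0.
have den_inj al : sq_den (H_mubar J 1 (0 + 1)) al -> al = 0.
  move=> [be [ga [tbe ga0 ->]]].
  by rewrite (is_type_neg _ tbe)// /d_mubar d_component0 ga0 addr0.
apply: (@sq_dim_eq _ _ _ _ e).
- move=> k; have Lk := enum_valP k; split; last by rewrite /d_delbar d_component_dz.
  by split; [exact: dz_form_type|rewrite /d_mubar/= d_component_dz].
- move=> c [be [ga [[tbe _] [be' [ga' [tbe' ga0 gaE]]] E]]]; apply: dz_free; rewrite E gaE.
  rewrite (is_type_neg _ tbe)// (is_type_neg _ tbe')// ga0.
  by rewrite /d_delbar /d_mubar !d_component0 !addr0.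
- exists 0, 0; split.
  + by split; [exact: is_type0|rewrite /d_mubar/= d_component0].
  + exists 0, 0; split; [exact: is_type0|by []|].
    by rewrite /d_mubar d_component0 addr0.
  + by rewrite /d_delbar d_component0 addr0.
- move=> al [[tal _] /den_inj D0]; apply: dz_span => // x.
  by rewrite D0.
Qed.

Let ext_innerJ x (a b : ext R N) : ext_inner (J x) a b =
    \sum_I a I * conjc (b I : C) * (weight dg x I)%:C%C.
Proof. by apply: ext_innerE => ? *; [exact: dg_gt0|exact: metric_Jst]. Qed.

Lemma ext_inner_sum (T : finType) x (a : T -> ext R N) b :
  ext_inner (J x) (\sum_t a t) b = \sum_t ext_inner (J x) (a t) b.
Proof.
rewrite ext_innerJ; under [RHS]eq_bigr do rewrite ext_innerJ.
rewrite [RHS]exchange_big/=; apply: eq_bigr => I _.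
by rewrite sum_ffunE !mulr_suml.
Qed.

(* Hence delbar^* and mu^* vanish on (1,0)-forms. *)
Lemma type_orthogonal x p q (a b : ext R N) : coef10 o s x b -> (p, q) != (1, 0) ->
  ext_inner (J x) (type_proj (J x) p q a) b = 0.
Proof.
move=> [b1 bE] pq.
have z : ext_inner (J x) 0 b = 0.
  by rewrite ext_innerJ big1// => I _; rewrite ffunE !mul0r.
have [/type_proj_neg ->//|] := boolP ((p < 0) || (q < 0)).
rewrite negb_or -!leNgt => /andP[p0 q0].
rewrite ext_innerJ sum_card1 => [|I I1]; last by rewrite b1// conjc0 mulr0 mul0r.
have [pq1|pq1] := eqVneq (p + q) 1; last first.
  by rewrite big1// => i _; rewrite type_proj_degree ?mul0r// cards1 eq_sym.
have [-> ->] : p = 0 /\ q = 1.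
  move: p q p0 q0 pq1 pq {z} => [[|[|p]]|p] [[|[|q]]|q] //= _ _; by rewrite -PoszD => -[]; lia.
under eq_bigr do rewrite type_proj01 mulr_suml mulr_suml.
rewrite exchange_big/= big1// => k _.
under eq_bigr do rewrite -!mulrA.
rewrite -mulr_sumr.
pose y i : C := conjc (b [set i]%SET : C) * (weight dg x [set i]%SET)%:C%C.
suff -> : \sum_i ((k == i)%:R + 'i%C * (J x k i)%:C%C) * (2^-1 *
    (conjc (b [set i]%SET : C) * (weight dg x [set i]%SET)%:C%C)) = 0 by rewrite mulr0.
(* [y] is the metric dual of the conjugate of [b], hence a vector of type (1,0), and the (0,1) part
   of [dx^k] annihilates it. *)
transitivity (dual (dx01 (J x)) k y).
  by apply: eq_bigr => i _; rewrite mulrA.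
rewrite dual_dx01// (_ : y k = 'i%C * (eps R k * dg (sigma k) x)%:C%C * y (sigma k)).
  by rewrite subrr mul0r.
rewrite /y /weight !big_set1 bE dg_sigma// invrK.
have := dg_gt0 o s k x; move: (dg k x) (eps R k) (b _) => g ep [b1' b2'] /gt_eqF g0.
apply/eqP; rewrite eq_complex /=; apply/andP; split; apply/eqP; field; by rewrite g0.
Qed.

Lemma adjoint_value_type10 (a b : int) al :
  (forall p q : nat, (p%:Z + a, q%:Z + b) != (1, 0)) ->
  (forall x, coef10 o s x (al x)) -> is_adjoint_value J (d_component J a b) al 0.
Proof.
move=> ab cal; apply: (@adjoint_value0 _ _ _ dg).
- by move=> *; exact: dg_gt0.
- by move=> *; exact: metric_Jst.
move=> ga x _; rewrite /d_component fct_sumE ext_inner_sum big1// => p _.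
rewrite fct_sumE ext_inner_sum big1// => q _.
exact: type_orthogonal.
Qed.

Lemma harmonic_dz (a b : int) j : j \in free_pairs ->
  (forall p q : nat, (p%:Z + a, q%:Z + b) != (1, 0)) ->
  Defs.harmonic J (d_component J a b) 1 0 (dz_form j).
Proof.
move=> Lj ab; split; first exact: dz_form_type.
exists 0, 0; rewrite d_component_dz// d_component0 addr0; split=> //.
  by apply: adjoint_value_type10 => // x; exact: dz_form_coef10.
apply: adjoint_value_type10 => // x; split=> [I _|i]; rewrite !ffunE//.
by rewrite mulr0 oppr0.
Qed.

Lemma periodic_ext_d al : smooth_form al -> periodic (ext_d al : vec -> ext R N).
Proof.
move=> [pal _] i x; apply/ffunP => K; rewrite !ffunE; apply: eq_bigr => k _; congr (_ * _).
rewrite !partialCE; congr Complex; apply: periodic_pd => l y; by rewrite pal.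
Qed.

(** [laplacian_eq0] yields the vanishing on the unit cube; periodicity of [delbar al] extends it to
    the whole space. *)
Lemma harmonic_delbar_closed al : Defs.harmonic J (d_delbar J) 1 0 al ->
  forall x, d_delbar J al x = 0.
Proof.
move=> [tal lal] x.
have DE : d_delbar J al = form_proj J (1 + 0) (0 + 1) (ext_d al).
  exact: d_component10.
have pD : periodic (d_delbar J al : vec -> ext R N).
  rewrite DE => i y; rewrite /form_proj periodic_ext_d; last exact: tal.1.
  by have [[-> _ _] _ _] := compatible_Jst evenN o s_sigma.
have [y Cy ->//] := periodic_reduce x.
apply: (@laplacian_eq0 _ _ J dg) lal _ Cy.
- by move=> *; exact: dg_gt0.
- by move=> i; apply: smooth_continuous; exact: smooth_expc.
- by move=> z; exact: metric_Jst.
- by move=> z; exact: det_metric_Jst.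
- exact: tal.1.
move=> I; rewrite DE; apply: contC_type_proj => [i j|K].
  by apply: smooth_continuous; exact: smooth_Jst.
by apply: contC_ext_d; exact: tal.1.
Qed.

Lemma ell10 : ell J 1 0 = (#|free_pairs|%:R)%:E.
Proof.
apply: (@sq_dim_eq _ _ _ _ e) => //.
(* No bidegree [(p, q)] is sent to (1,0): for [delbar] because [q + 1 > 0], for [mu] because
   [p + 2 > 1]. *)
- by move=> k; have Lk := enum_valP k; split; apply: harmonic_dz => // p q;
    rewrite xpair_eqE negb_and; apply/orP; [right|left]; lia.
- exact: dz_free.
- by move=> al [hal _]; apply: dz_span; [exact: hal.1|exact: harmonic_delbar_closed].
Qed.

End HodgeNumbers.

(** * The infinite families of structures *)

Section TorusFamily.
Variables (R : realType) (n k : nat).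
Hypothesis k_bounds : (0 < k <= n)%N.
Local Notation N := (2 * n + 2)%N.

Let evenN : ~~ odd N.
Proof. by rewrite oddD oddM. Qed.

Let N_gt0 : (0 < N)%N.
Proof. by rewrite addn2. Qed.

Let o : 'I_N := Ordinal N_gt0.

(** Pairs 1 to [k] are twisted, while pair 0, which contains the coordinate the metric depends on,
    is not. The amplitude [t.+1] never vanishes, and [t] indexes the family. *)
Definition exponent (t : nat) (j : 'I_N) : R :=
  if (1 <= j./2 <= k)%N then (-1) ^+ odd j * t.+1%:R else 0.

Lemma exponent_sigma t j : exponent t (sigma j) = - exponent t j.
Proof.
have half_sigma : (sigma j)./2 = j./2.
  rewrite val_sigma//; case: (boolP (odd j)) => [oj|ej].
    case: (nat_of_ord j) oj => // m /= om; by rewrite uphalf_half (negbTE om).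
  by rewrite /= uphalf_half (negbTE ej).
rewrite /exponent half_sigma odd_sigma//; case: ifP => _; last by rewrite oppr0.
by rewrite -mulNr; congr (_ * _); case: odd; rewrite /= ?expr0 ?expr1 ?opprK.
Qed.

Lemma exponent0 t : exponent t o = 0.
Proof. by []. Qed.

Lemma card_free_pairs t : #|free_pairs (exponent t)| = (n - k + 1)%N.
Proof.
have -> : #|free_pairs (exponent t)| =
    (\sum_(0 <= j < 2 * n.+1) (~~ odd j && ~~ (1 <= j./2 <= k)))%N.
  rewrite -sum1_card big_mkcond/= (_ : 2 * n.+1 = N)%N; last by rewrite mulnS addnC.
  rewrite big_mkord; apply: eq_bigr => j _; rewrite inE.
  rewrite (_ : (exponent t j == 0) = ~~ (1 <= j./2 <= k)%N); first by case: (_ && _).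
  rewrite /exponent; case: ifP => _; last by rewrite eqxx.
  by rewrite mulf_eq0 signr_eq0 pnatr_eq0.
(* Among the pairs 0 to [m], those numbered 1 to [minn k m] are twisted and not counted. *)
have H m : (\sum_(0 <= j < 2 * m.+1) (~~ odd j && ~~ (1 <= j./2 <= k)) = m.+1 - minn k m)%N.
  elim: m => [|m IH].
    by rewrite muln1 !big_nat_recr ?big_nil//= minn0.
  have oM : odd (2 * m.+1) = false by rewrite oddM.
  have hM : ((2 * m.+1)./2 = m.+1)%N by rewrite mul2n doubleK.
  rewrite (_ : 2 * m.+2 = (2 * m.+1).+2)%N; last by rewrite !mulnS; lia.
  move: (2 * m.+1)%N IH oM hM => M IH oM hM.
  rewrite big_nat_recr// big_nat_recr//= IH uphalf_half oM hM /= addn0.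
  by case: (leqP m.+1 k) => mk; rewrite /=; lia.
rewrite H; lia.
Qed.

Definition Jfam t := Jst o (exponent t).

Lemma Jfam_inj : injective Jfam.
Proof.
move=> t t' E; have lt2 : (2 < N)%N by lia.
(* Index 2 opens pair 1, which is twisted as [k >= 1]. At the origin the cosine is one, so the
   matrix entry is [exp (t + 1)] up to sign and determines [t]. *)
pose j : 'I_N := Ordinal lt2.
have := congr1 (fun J : 'rV[R]_N -> 'M[R]_N => J 0 (sigma j) j) E.
rewrite /Jfam !JstE// sigmaK// eqxx !mul1r => /mulfI.
have e0 : - eps R (sigma j) != 0 by rewrite oppr_eq0 signr_eq0.
move=> /(_ e0); rewrite /dg /expc => /expR_inj.
rewrite /cosc mxE mulr0 cos0 !mulr1 /exponent /=.
have [-> _] := andP k_bounds.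
by rewrite expr0 !mul1r => /eqP; rewrite eqr_nat => /eqP [].
Qed.

Lemma Jfam_compatible t : omega0_compatible (Jfam t).
Proof. exact: compatible_Jst (exponent_sigma t). Qed.

Lemma h_Dol_Jfam t : h_Dol (Jfam t) 1 0 = ((n - k + 1)%:R)%:E.
Proof. by rewrite (h_Dol10 evenN (exponent_sigma t) _ (exponent0 t))// card_free_pairs. Qed.

Lemma ell_Jfam t : ell (Jfam t) 1 0 = ((n - k + 1)%:R)%:E.
Proof. by rewrite (ell10 evenN (exponent_sigma t) _ (exponent0 t))// card_free_pairs. Qed.

End TorusFamily.

Lemma infinite_of_injective (T : Type) (A : set T) (f : nat -> T) :
  injective f -> (forall t, A (f t)) -> infinite_set A.
Proof.
move=> finj fA Afin; apply: infinite_nat.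
have -> : [set: nat] = f @^-1` A by apply/seteqP; split => // t _; exact: fA.
by apply: finite_preimage Afin => ? ? _ _; exact: finj.
Qed.

Theorem theorem1p1 (R : realType) (n : nat) (n_gt0 : (0 < n)%N) :
  infinite_set [set J : 'rV[R]_(2 * n + 2) -> 'M[R]_(2 * n + 2) |
    [/\ omega0_compatible J,
        (2%:E * h_Dol J 1 0 < betti R (2 * n + 2) 1)%E
      & (2%:E * h_Dol J 1 0 = 2%:E * ell J 1 0)%E]] /\
  (forall k : nat, (0 < k <= n)%N ->
    infinite_set [set J : 'rV[R]_(2 * n + 2) -> 'M[R]_(2 * n + 2) |
      [/\ omega0_compatible J,
          h_Dol J 1 0 = ((n - k + 1)%:R)%:E
        & ell J 1 0 = ((n - k + 1)%:R)%:E]]).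
Proof.
split=> [|k k_bounds].
  (* A single twisted pair gives [h^{1,0} = n], and [2 n < 2 n + 2 <= b^1]. *)
  have n1 : (0 < 1 <= n)%N by [].
  apply: (infinite_of_injective (Jfam_inj (R := R) n1)) => t; split.
  - exact: Jfam_compatible.
  - rewrite h_Dol_Jfam// (lt_le_trans _ (betti1_ge R _))// -EFinM lte_fin -natrM ltr_nat.
    by rewrite subnK// addn2 ltnS leqnSn.
  - by rewrite h_Dol_Jfam// ell_Jfam.
apply: (infinite_of_injective (Jfam_inj (R := R) k_bounds)) => t; split.
- exact: Jfam_compatible.
- exact: h_Dol_Jfam.
- exact: ell_Jfam.
Qed.
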